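(* Let $p\in(1,\infty)$ and put $$c_p=\begin{cases}\dfrac{1}{p\sqrt{2}}\left(\dfrac{p-1}{p}\right)^{p+\frac12} & \text{for } 1<p<2,\\[2mm] \dfrac12 & \text{for } p=2,\\[2mm] \dfrac{\sqrt 2}{p}\left(\dfrac{p-1}{p}\right)^{\frac{p-1}{2}} & \text{for } p>2,\end{cases}\qquad C_p=\begin{cases}\dfrac{1}{\sqrt{p(p-1)/2}} & \text{for } 1<p<2,\\[2mm] 1 & \text{for } p=2,\\[2mm] \sqrt{2p} & \text{for } p>2.\end{cases}$$ Then for every real-valued martingale $(X_n)_{n=1}^{\infty}$, $$c_p^p\,\mathbb{E}\,(X_n^{*})^{p}\le \mathbb{E}\, S_n(X)^p\le C_p^p\,\mathbb{E}\,(X_n^{*})^{p},\qquad n=1,2,\ldots,$$ where $X_n^*=\max_{1\le j\le n}|X_j|$, $S_n(X)=\bigl(\sum_{j=1}^{n}(\Delta X_j)^2\bigr)^{1/2}$, $\Delta X_n=X_n-X_{n-1}$ for $n\ge 1$, and $X_0=0$.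
   Context: The martingale $(X_n)_{n=1}^\infty$ is in discrete time, on an arbitrary probability space and with respect to an arbitrary filtration $(\mathcal{F}_n)_{n=1}^{\infty}$. By the convention $X_0=0$ we have $\Delta X_1=X_1$; the variable $X_1$ is not assumed to have mean zero. The expectations in the inequality are of nonnegative random variables and take values in $[0,\infty]$. *)

(* Defs.v *)
From HB Require Import structures.
From mathcomp Require Import all_boot all_order all_algebra.
From mathcomp Require Import all_classical all_reals all_analysis.
Set Implicit Arguments.
Unset Strict Implicit.
Unset Printing Implicit Defensive.
Import Order.TTheory GRing.Theory Num.Theory.
Import numFieldNormedType.Exports.
Local Open Scope classical_set_scope.
Local Open Scope ring_scope.

(* Discrete time starts at 1: the value at index 0 of a filtration is junk and
   is never used, and the value at index 0 of a process only enters through the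
   first increment. *)

Definition filtration d (T : measurableType d) (F : nat -> set (set T)) :=
  forall n, (1 <= n)%N ->
    [/\ sigma_algebra setT (F n), F n `<=` measurable & F n `<=` F n.+1].

(* For G a sigma-algebra, <<s G>> = G, so that measurability on
   g_sigma_algebraType G is measurability with respect to G itself. *)
Definition measurable_wrt d (T : measurableType d) (R : realType)
    (G : set (set T)) (Y : T -> R) :=
  measurable_fun setT (Y : g_sigma_algebraType G -> R).

(* Y is a version of the conditional expectation E[X | G]. *)
Definition is_cond_exp d (T : measurableType d) (R : realType)
    (P : probability T R) (G : set (set T)) (X Y : T -> R) :=
  [/\ measurable_wrt G Y, P.-integrable setT (EFin \o Y) &
      forall A, G A ->
        (\int[P]_(w in A) (Y w)%:E = \int[P]_(w in A) (X w)%:E)%E].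

Definition martingale d (T : measurableType d) (R : realType)
    (P : probability T R) (F : nat -> set (set T)) (X : nat -> T -> R) :=
  forall n, (1 <= n)%N ->
    [/\ measurable_wrt (F n) (X n), P.-integrable setT (EFin \o X n) &
        is_cond_exp P (F n) (X n.+1) (X n)].

(* To be used for 1 <= n; at n = 0 this is junk since 0.-1 = 0. *)
Definition increment (T : Type) (R : realType) (X : nat -> T -> R) (n : nat)
    (w : T) : R := X n w - X n.-1 w.

(* The base value 0 of the iterated maximum is harmless: the terms are >= 0. *)
Definition running_max (T : Type) (R : realType) (X : nat -> T -> R) (n : nat)
    (w : T) : R := \big[Num.max/0]_(1 <= j < n.+1) `|X j w|.

Definition square_function (T : Type) (R : realType) (X : nat -> T -> R)
    (n : nat) (w : T) : R :=
  Num.sqrt (\sum_(1 <= j < n.+1) increment X j w ^+ 2).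

(* Only meaningful for 1 < p. *)
Definition lower_const (R : realType) (p : R) : R :=
  if p < 2 then (p * Num.sqrt 2)^-1 * ((p - 1) / p) `^ (p + 2^-1)
  else if p == 2 then 2^-1
  else Num.sqrt 2 / p * ((p - 1) / p) `^ ((p - 1) / 2).

Definition upper_const (R : realType) (p : R) : R :=
  if p < 2 then (Num.sqrt (p * (p - 1) / 2))^-1
  else if p == 2 then 1
  else Num.sqrt (2 * p).

(* Main.v *)
Require Import Defs.
From mathcomp Require Import all_boot all_order all_algebra.
From mathcomp Require Import all_classical all_reals all_analysis.
From mathcomp Require Import measurable_realfun.
From mathcomp Require Import zify ring lra.
Import Order.TTheory GRing.Theory Num.Theory.
Import numFieldNormedType.Exports.
Local Open Scope classical_set_scope.
Local Open Scope ring_scope.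

(** Each of the two inequalities comes from an inequality between numbers that
    holds along every real sequence [x] with [x 0 = 0] and has the shape
[[
      A <= c * B + sum_(k < n) z k * (x k.+1 - x k),
]]
    where [A] and [B] are the [p]-th powers of the maximal function [M] and of
    the square function [S] in one order or the other, and [z k] depends on
    [x 0, ..., x k] only, with [z 0 = 0].  Along a martingale the sum has mean
    zero ([transform_dominated]): [z k] is measurable with respect to [F k], and
    [z k * (X k.+1 - X k)] is at most a constant times [B], hence integrable as
    soon as [B] is.  The martingale enters only through the vanishing of the
    integrals of such products ([integral_mul_eq0]).  The condition [z 0 = 0]
    removes the first increment [X 1], whose mean is arbitrary.

    The pathwise inequalities rest on three ingredients, in which all uses of
    the inequality of Hoelder are replaced by that of Young.
    - Doob: [M^p <= q^p |x n|^p - ...] with [q = p / (p - 1)], where the weights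
      are those of the transform of [x] by [M^(p-1) sg x] ([doob_path]).
    - Taylor: the second derivative of [|x|^p] is [p (p - 1) |x|^(p-2)], so that
      between [-M] and [M] the second order remainder compares with
      [p (p - 1) / 2 * M^(p-2)] times the squared increment; the
      comparison is an upper bound for [p >= 2] ([taylor_path_le]) and a lower
      bound for [p <= 2] ([taylor_path_ge]).
    - Potentials in the two variables [x] and [y = S^2]: for [p > 2], a
      summation by parts of [sum_k y_k^(p/2-1) (x_k - x_(k-1))^2]
      ([garsia_path]); for [p < 2], the function
      [(x^2 + y)^(p/2) - 4 y^(p/2)], whose increments are at most linear in the
      increment of [x] ([square_step], [square_path]).

    The upper estimate is Taylor combined with the arithmetic-geometric mean
    inequality for [p <= 2], and summation by parts for [p > 2].  The lower
    estimate is Doob combined with Taylor for [p >= 2], which gives exactly the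
    stated constant, and Doob combined with the potential for [p < 2], which
    gives [M^p <= 4 q^p S^p + ...], where [4 q^p] does not exceed the inverse of
    [lower_const p ^ p] ([lower_const_lt2]). *)

(** * Inequalities for real powers *)

(** Young's inequality with the conjugate exponents [1 / t] and [1 / (1 - t)]. *)
Lemma powR_amgm {R : realType} (a b t : R) : 0 <= a -> 0 <= b -> 0 <= t <= 1 ->
  a `^ t * b `^ (1 - t) <= t * a + (1 - t) * b.
Proof.
move=> a0 b0 /andP[t0 t1].
have [->|tn0] := eqVneq t 0; first by rewrite subr0 powRr0 powRr1 // mul0r mul1r add0r.
have [->|tn1] := eqVneq t 1; first by rewrite subrr powRr0 powRr1 // mul0r mulr1 addr0 mul1r.
have tgt0 : 0 < t by rewrite lt_def tn0.
have tlt1 : 0 < 1 - t by rewrite subr_gt0 lt_neqAle tn1.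
have := @conjugate_powR R (a `^ t) (b `^ (1 - t)) t^-1 (1 - t)^-1.
rewrite !invrK -!powRrM !divff ?gt_eqF // !powRr1 // mulrC [b * _]mulrC [a * _]mulrC.
apply => //; rewrite ?powR_ge0 ?invr_gt0 //; lra.
Qed.

Lemma powRB1K {R : realType} (a s : R) : 0 <= a -> 0 < s -> a `^ (s - 1) * a = a `^ s.
Proof. by move=> a0 s0; rewrite mulrC mulr_powRB1. Qed.

(** Young's inequality with exponents [s / (s - 1)] and [s], cleared of
    denominators so that it also covers [s = 1]. *)
Lemma powR_young {R : realType} (a b s : R) : 0 <= a -> 0 <= b -> 1 <= s ->
  s * (a `^ (s - 1) * b) <= (s - 1) * a `^ s + b `^ s.
Proof.
move=> a0 b0 s1; have s0 : 0 < s by lra.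
have si0 : 0 <= s^-1 by rewrite invr_ge0 ltW.
have := @powR_amgm R (b `^ s) (a `^ s) s^-1 (powR_ge0 _ _) (powR_ge0 _ _).
rewrite si0 invf_le1 // s1 => /(_ erefl).
rewrite -!powRrM divff ?gt_eqF // powRr1 // mulrBr mulr1 divff ?gt_eqF //.
move=> /(ler_wpM2l (ltW s0)) H.
rewrite [a `^ _ * _]mulrC (le_trans H) //.
rewrite mulrDr !mulrA mulrBr mulr1 divff ?gt_eqF // mul1r; lra.
Qed.

(** The graph of the convex function [b |-> b^s], [s >= 1], lies above its
    tangent at [a]. *)
Lemma powR_tangent_ge {R : realType} (a b s : R) : 0 <= a -> 0 <= b -> 1 <= s ->
  a `^ s + s * a `^ (s - 1) * (b - a) <= b `^ s.
Proof.
move=> a0 b0 s1; have := @powR_young R a b s a0 b0 s1.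
have := @powRB1K R a s a0; rewrite (lt_le_trans ltr01 s1) => /(_ erefl) H.
have -> : s * a `^ (s - 1) * (b - a) = s * (a `^ (s - 1) * b) - s * (a `^ (s - 1) * a) by ring.
rewrite H; lra.
Qed.

(** For [0 <= s <= 1] the power is concave and lies below its tangents.  At
    [a = 0] there is none for [s < 1]. *)
Lemma powR_tangent_le {R : realType} (a b s : R) : 0 < a -> 0 <= b -> 0 <= s <= 1 ->
  b `^ s <= a `^ s + s * a `^ (s - 1) * (b - a).
Proof.
move=> a0 b0 s01; have := @powR_amgm R b a s b0 (ltW a0) s01.
have p0 : 0 < a `^ (s - 1) by exact: powR_gt0.
move=> /(ler_wpM2l (ltW p0)).
have E1 : a `^ (s - 1) * a `^ (1 - s) = 1.
  by rewrite -powRD ?(gt_eqF a0) ?implybT // (_ : s - 1 + (1 - s) = 0) ?powRr0 //; ring.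
have E2 : a `^ (s - 1) * a = a `^ s.
  rewrite -[X in _ * X]powRr1 ?ltW // -powRD ?(gt_eqF a0) ?implybT //.
  by congr powR; ring.
rewrite mulrCA E1 mulr1 => /le_trans; apply.
rewrite -E2; lra.
Qed.

(** * Second order Taylor bounds for the power of the absolute value *)

(** Cutting the unit interval into [n] equal steps bounds [h 1 - h 0] by [n * C / n^2],
    which is arbitrarily small.  This stands in for the mean value theorem and
    avoids differentiating powers at the origin. *)
Lemma le_of_quadratic_increments {R : realType} (h : R -> R) (C : R) :
  (forall s t, 0 <= s -> s <= t -> t <= 1 -> h t - h s <= C * (t - s) ^+ 2) ->
  h 1 <= h 0.
Proof.
move=> hC; rewrite leNgt; apply/negP => h01.
have e0 : 0 < h 1 - h 0 by rewrite subr_gt0.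
have [k] : exists k : nat, C < (h 1 - h 0) * k.+1%:R.
  exists (Num.truncn (C / (h 1 - h 0))).
  by rewrite -ltr_pdivrMl // mulrC; apply: truncnS_gt.
apply/negP; rewrite -leNgt.
have k0 : 0 < k.+1%:R :> R by rewrite ltr0n.
have kn0 : k.+1%:R != 0 :> R by rewrite gt_eqF.
have <- : \sum_(0 <= i < k.+1) (h (i.+1%:R / k.+1%:R) - h (i%:R / k.+1%:R)) = h 1 - h 0.
  by rewrite (telescope_sumr (fun i => h (i%:R / k.+1%:R))) // divff // mul0r.
rewrite -ler_pdivlMr //.
have -> : C / k.+1%:R = \sum_(0 <= i < k.+1) C * k.+1%:R^-1 ^+ 2.
  by rewrite sumr_const_nat subn0 -mulr_natr; field.
rewrite ler_sum_nat // => i /andP[_ ik].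
have -> : C * k.+1%:R^-1 ^+ 2 = C * (i.+1%:R / k.+1%:R - i%:R / k.+1%:R) ^+ 2.
  by rewrite -mulrBl -natrB // subSnn mul1r.
by apply: hC; rewrite ?divr_ge0 ?ler_pM2r ?invr_gt0 ?ler_nat // ler_pdivrMr // mul1r ler_nat.
Qed.

(** The derivative of [|x|^p] for [p > 1]. *)
Definition dpow {R : realType} (p x : R) : R := p * (Num.sg x * `|x| `^ (p - 1)).

Lemma dpow0 {R : realType} (p : R) : dpow p 0 = 0.
Proof. by rewrite /dpow sgr0 mul0r mulr0. Qed.

Lemma dpowN {R : realType} (p x : R) : dpow p (- x) = - dpow p x.
Proof. by rewrite /dpow sgrN normrN mulNr mulrN. Qed.

Lemma dpow_ge0 {R : realType} (p x : R) : 1 < p -> 0 <= x -> dpow p x = p * x `^ (p - 1).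
Proof.
move=> p1; rewrite le_eqVlt => /predU1P[<-|x0].
  by rewrite dpow0 powR0 ?mulr0 // gt_eqF // subr_gt0.
by rewrite /dpow gtr0_sg // gtr0_norm // mul1r.
Qed.

Lemma normr_dpow_le {R : realType} (p x : R) : 1 < p -> `|dpow p x| <= p * `|x| `^ (p - 1).
Proof.
move=> p1; have p0 : 0 < p by lra.
rewrite /dpow !normrM (gtr0_norm p0) ler_pM2l // (ger0_norm (powR_ge0 _ _)).
by rewrite normr_sg; case: (x == 0); rewrite ?mul0r ?powR_ge0 // mul1r.
Qed.

Lemma dpow_tangent {R : realType} (p x y : R) : 1 < p ->
  dpow p x * (y - x) <= `|y| `^ p - `|x| `^ p.
Proof.
move=> p1; rewrite lerBrDl.
apply: le_trans (@powR_tangent_ge R `|x| `|y| p (normr_ge0 _) (normr_ge0 _) (ltW p1)).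
have -> : dpow p x * (y - x) = p * `|x| `^ (p - 1) * (Num.sg x * (y - x)) by rewrite /dpow; ring.
rewrite lerD2l ler_wpM2l //; first by rewrite mulr_ge0 ?powR_ge0 //; lra.
rewrite mulrBr -normrEsg lerD2r -[`|y|]mul1r (le_trans (ler_norm _)) //.
by rewrite normrM ler_wpM2r // normr_sg lern1 leq_b1.
Qed.

(** The derivative of [dpow p] is [p (p - 1) |t|^(p-2)], which is at most its
    value at [m] for [|t| <= m] when [p >= 2].  Signs are dealt with by oddness:
    an interval around the origin is cut there. *)
Lemma dpow_slope_le {R : realType} (p m x y : R) : 2 <= p ->
  `|x| <= m -> `|y| <= m ->
  (dpow p y - dpow p x) * (y - x) <= p * (p - 1) * m `^ (p - 2) * (y - x) ^+ 2.
Proof.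
move=> p2.
have key a b : 0 <= a -> a <= b -> b <= m ->
    dpow p b - dpow p a <= p * (p - 1) * m `^ (p - 2) * (b - a).
  move=> a0 ab bm; have b0 := le_trans a0 ab; have m0 := le_trans b0 bm.
  rewrite !dpow_ge0 //; [|lra..].
  rewrite -mulrBr -!mulrA ler_wpM2l //; first by lra.
  have := @powR_tangent_ge R b a (p - 1) b0 a0; rewrite (_ : p - 1 - 1 = p - 2); last by ring.
  have p11 : 1 <= p - 1 by lra.
  move=> /(_ p11) H.
  have : b `^ (p - 1) - a `^ (p - 1) <= (p - 1) * (b `^ (p - 2) * (b - a)) by lra.
  move/le_trans; apply; rewrite ler_wpM2l //; first by lra.
  by rewrite ler_wpM2r ?subr_ge0 // ge0_ler_powR // subr_ge0.
have p1 : 1 < p by lra.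
have key' a b : a <= b -> `|a| <= m -> `|b| <= m ->
    dpow p b - dpow p a <= p * (p - 1) * m `^ (p - 2) * (b - a).
  move=> ab; rewrite !ler_norml => /andP[am am'] /andP[bm bm'].
  have [a0|/ltW a0] := leP 0 a; first exact: key.
  have [b0|/ltW b0] := leP 0 b; last first.
    have := key (- b) (- a); rewrite !dpowN oppr_ge0 lerN2 lerNl => /(_ b0 ab am); lra.
  have := key 0 (- a); have := key 0 b; rewrite dpowN dpow0 oppr_ge0 lerNl.
  move=> /(_ (lexx _) b0 bm') H /(_ (lexx _) a0 am) H'; lra.
move=> xm ym; have [xy|/ltW yx] := leP x y.
  by rewrite expr2 mulrA ler_wpM2r ?subr_ge0 //; exact: key'.
rewrite -mulrNN !opprB expr2 -[X in _ <= _ * X]mulrNN !opprB mulrA.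
by rewrite ler_wpM2r ?subr_ge0 //; exact: key'.
Qed.

(** For [p <= 2] the exponent [p - 2] is nonpositive and the comparison of
    [dpow_slope_le] is reversed. *)
Lemma dpow_slope_ge {R : realType} (p m x y : R) : 1 < p <= 2 ->
  `|x| <= m -> `|y| <= m ->
  p * (p - 1) * m `^ (p - 2) * (y - x) ^+ 2 <= (dpow p y - dpow p x) * (y - x).
Proof.
move=> /andP[p1 p2].
have key a b : 0 <= a -> a <= b -> b <= m ->
    p * (p - 1) * m `^ (p - 2) * (b - a) <= dpow p b - dpow p a.
  move=> a0 ab bm; have b0 := le_trans a0 ab.
  move: b0 ab bm; rewrite le_eqVlt => /predU1P[<-|b0] ab bm.
    by rewrite (@le_anti _ R a 0 _) ?ab // !subrr mulr0.
  rewrite !dpow_ge0 //; [|exact: ltW].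
  rewrite -mulrBr -!mulrA ler_wpM2l //; first by lra.
  have p01 : 0 <= p - 1 <= 1 by lra.
  have := @powR_tangent_le R b a (p - 1) b0 a0 p01.
  rewrite (_ : p - 1 - 1 = p - 2); last by ring.
  move=> H; have : (p - 1) * (b `^ (p - 2) * (b - a)) <= b `^ (p - 1) - a `^ (p - 1) by lra.
  apply: le_trans; rewrite ler_wpM2l //; first by lra.
  rewrite ler_wpM2r ?subr_ge0 //.
  rewrite -[p - 2]opprB !powRN lef_pV2 ?posrE ?powR_gt0 //; last exact: lt_le_trans bm.
  by rewrite ge0_ler_powR ?nnegrE ?subr_ge0 // ?ltW // (lt_le_trans b0).
have key' a b : a <= b -> `|a| <= m -> `|b| <= m ->
    p * (p - 1) * m `^ (p - 2) * (b - a) <= dpow p b - dpow p a.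
  move=> ab; rewrite !ler_norml => /andP[am am'] /andP[bm bm'].
  have [a0|/ltW a0] := leP 0 a; first exact: key.
  have [b0|/ltW b0] := leP 0 b; last first.
    have := key (- b) (- a); rewrite !dpowN oppr_ge0 lerN2 lerNl => /(_ b0 ab am); lra.
  have := key 0 (- a); have := key 0 b; rewrite dpowN dpow0 oppr_ge0 lerNl.
  move=> /(_ (lexx _) b0 bm') H /(_ (lexx _) a0 am) H'; lra.
move=> xm ym; have [xy|/ltW yx] := leP x y.
  by rewrite expr2 mulrA ler_wpM2r ?subr_ge0 //; exact: key'.
rewrite -(mulrNN (_ - _) (y - x)) !opprB expr2 -[X in _ * X <= _]mulrNN !opprB mulrA.
by rewrite ler_wpM2r ?subr_ge0 //; exact: key'.
Qed.

Lemma normr_segment_le {R : realType} (m x y t : R) : `|x| <= m -> `|y| <= m ->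
  0 <= t <= 1 -> `|x + t * (y - x)| <= m.
Proof. rewrite !ler_norml => /andP[? ?] /andP[? ?] /andP[? ?]; apply/andP; split; nra. Qed.

(** Along the segment from [x] to [y], the difference [h] of [|.|^p] and its
    quadratic Taylor majorant at [x] has increments of second order:
    [dpow_tangent] at the right end of each step and [dpow_slope_le] leave
    only a quadratic error. *)
Lemma taylor_powR_le {R : realType} (p m x y : R) : 2 <= p ->
  `|x| <= m -> `|y| <= m ->
  `|y| `^ p <= `|x| `^ p + dpow p x * (y - x)
               + p * (p - 1) / 2 * (m `^ (p - 2) * (y - x) ^+ 2).
Proof.
move=> p2 xm ym; have p1 : 1 < p by lra.
set e := y - x; set K := p * (p - 1) * m `^ (p - 2).
pose h (t : R) := `|x + t * e| `^ p - t * (dpow p x * e) - K * e ^+ 2 / 2 * t ^+ 2.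
have := @le_of_quadratic_increments R h (K * e ^+ 2 / 2).
have -> : h 1 = `|y| `^ p - dpow p x * e - K * e ^+ 2 / 2.
  by rewrite /h !mul1r expr1n mulr1 /e (addrC x) subrK.
have -> : h 0 = `|x| `^ p by rewrite /h !mul0r expr0n mulr0 !subr0 addr0.
move=> H; suff /H : forall s t, 0 <= s -> s <= t -> t <= 1 ->
    h t - h s <= K * e ^+ 2 / 2 * (t - s) ^+ 2 by rewrite /K; lra.
move=> s t s0 st t1; have t0 := le_trans s0 st.
have sl : t * (dpow p (x + t * e) * e) <= t * (dpow p x * e) + t ^+ 2 * (K * e ^+ 2).
  have tm : `|x + t * e| <= m by apply: normr_segment_le => //; rewrite t0.
  have := @dpow_slope_le R p m x (x + t * e) p2 xm tm; rewrite -/K.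
  by rewrite (_ : x + t * e - x = t * e); [lra | ring].
have {sl} sl : (t - s) * (dpow p (x + t * e) * e) <= (t - s) * (dpow p x * e + t * (K * e ^+ 2)).
  rewrite ler_wpM2l ?subr_ge0 //; move: t0; rewrite le_eqVlt => /predU1P[t0|t0].
    by rewrite -t0 !mul0r !addr0.
  by rewrite -(ler_pM2l t0); lra.
have := @dpow_tangent R p (x + t * e) (x + s * e) p1.
rewrite /h (_ : x + s * e - (x + t * e) = (s - t) * e); [lra | ring].
Qed.

(** As [taylor_powR_le], with the tangent at the left end of each step. *)
Lemma taylor_powR_ge {R : realType} (p m x y : R) : 1 < p <= 2 ->
  `|x| <= m -> `|y| <= m ->
  `|x| `^ p + dpow p x * (y - x) + p * (p - 1) / 2 * (m `^ (p - 2) * (y - x) ^+ 2)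
  <= `|y| `^ p.
Proof.
move=> p12 xm ym; have /andP[p1 p2] := p12.
set e := y - x; set K := p * (p - 1) * m `^ (p - 2).
pose h (t : R) := t * (dpow p x * e) + K * e ^+ 2 / 2 * t ^+ 2 - `|x + t * e| `^ p.
have := @le_of_quadratic_increments R h (K * e ^+ 2 / 2).
have -> : h 1 = dpow p x * e + K * e ^+ 2 / 2 - `|y| `^ p.
  by rewrite /h !mul1r expr1n mulr1 /e (addrC x) subrK.
have -> : h 0 = - `|x| `^ p by rewrite /h !mul0r expr0n mulr0 !addr0 add0r.
move=> H; suff /H : forall s t, 0 <= s -> s <= t -> t <= 1 ->
    h t - h s <= K * e ^+ 2 / 2 * (t - s) ^+ 2 by rewrite /K; lra.
move=> s t s0 st t1; have s1 := le_trans st t1.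
have sl : s * (dpow p x * e) + s ^+ 2 * (K * e ^+ 2) <= s * (dpow p (x + s * e) * e).
  have sm : `|x + s * e| <= m by apply: normr_segment_le => //; rewrite s0.
  have := @dpow_slope_ge R p m x (x + s * e) p12 xm sm; rewrite -/K.
  by rewrite (_ : x + s * e - x = s * e); [lra | ring].
have {sl} sl : (t - s) * (dpow p x * e + s * (K * e ^+ 2)) <= (t - s) * (dpow p (x + s * e) * e).
  rewrite ler_wpM2l ?subr_ge0 //; move: s0; rewrite le_eqVlt => /predU1P[s0|s0].
    by rewrite -s0 !mul0r !addr0.
  by rewrite -(ler_pM2l s0); lra.
have := @dpow_tangent R p (x + s * e) (x + t * e) p1.
rewrite /h (_ : x + t * e - (x + s * e) = (t - s) * e); [lra | ring].
Qed.

(** * A potential for exponents below 2 *)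

Lemma powR_half_sqr {R : realType} (a p : R) : 0 <= a -> (a ^+ 2) `^ (p / 2) = a `^ p.
Proof.
move=> a0; rewrite -(powR_mulrn 2) // -powRrM; congr powR.
by field.
Qed.

(** With [a = sqrt y] and [b = sqrt (y + 1)], so that [b^2 = a^2 + 1], tangents
    at 1 give [b^p >= 1 + p (b - 1)] and [a^(p-1) <= 1 + (p - 1) (a - 1)].  What
    is left is affine in [p], hence follows from its cases [p = 1] (bound [E0])
    and [p = 2] (bound [E1]), which are polynomial inequalities in [a]. *)
Lemma powR_gap_ge {R : realType} (p y : R) : 1 < p < 2 -> 0 <= y <= 1 ->
  1 + 3 / 2 * p - y <= 4 * ((y + 1) `^ (p / 2) - y `^ (p / 2)).
Proof.
move=> /andP[p1 p2] /andP[y0 y1].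
set a := Num.sqrt y; set b := Num.sqrt (y + 1).
have a0 : 0 <= a by exact: sqrtr_ge0.
have b0 : 0 <= b by exact: sqrtr_ge0.
have ay : a ^+ 2 = y by rewrite sqr_sqrtr.
have bay : b ^+ 2 = a ^+ 2 + 1 by rewrite ay sqr_sqrtr // addr_ge0.
have a1 : a <= 1 by rewrite -sqrtr1 ler_wsqrtr.
have b1 : 1 <= b by nra.
have -> : (y + 1) `^ (p / 2) = b `^ p by rewrite -[b `^ p]powR_half_sqr // bay ay.
have -> : y `^ (p / 2) = a `^ p by rewrite -[a `^ p]powR_half_sqr // ay.
have Hb : 1 + p * (b - 1) <= b `^ p.
  have := @powR_tangent_ge R 1 b p ler01 b0 (ltW p1).
  by rewrite !powR1 mulr1.
have Ha : a `^ p <= a * (1 + (p - 1) * (a - 1)).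
  rewrite -mulr_powRB1 // ?(lt_trans ltr01) // ler_wpM2l //.
  have := @powR_tangent_le R 1 a (p - 1) ltr01 a0.
  by rewrite !powR1 mulr1; apply; lra.
have E0 : 5 / 2 - a ^+ 2 <= 4 * (b - a).
  (* The quartic in [a] to be shown nonnegative has its minimum near 0.77. *)
  have Hc : 0 <= a * (a - 77 / 100) ^+ 2 by rewrite mulr_ge0 // sqr_ge0.
  have Hd : a ^+ 4 <= a ^+ 3.
    by rewrite exprS ler_piMl // exprn_ge0.
  have : (5 / 2 + 4 * a - a ^+ 2) ^+ 2 <= (4 * b) ^+ 2.
    rewrite exprMn bay; nra.
  by rewrite ler_sqr ?nnegrE; [lra | nra | lra].
have E1 : 4 - a ^+ 2 <= 4 * (2 * b - 1 - a ^+ 2).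
  have : (1 + 3 / 8 * a ^+ 2) ^+ 2 <= b ^+ 2 by rewrite bay; nra.
  by rewrite ler_sqr ?nnegrE; [lra | nra | lra].
rewrite -ay; nra.
Qed.

(** The case [d = 1] of [square_step] when the jump dominates: [x^2 + y < 1].
    The tangent at 1 bounds the new value of the potential, and the linear term
    [p N^(p/2-1) x], singular at [N = 0], costs at most [p (1 - y / 2)] because
    [x^2 = N - y <= N (1 - y / 2)^2]. *)
Lemma square_step_normalized {R : realType} (p x y : R) : 1 < p < 2 -> 0 <= y -> x ^+ 2 + y < 1 ->
  ((x + 1) ^+ 2 + (y + 1)) `^ (p / 2) - 4 * (y + 1) `^ (p / 2)
  <= (x ^+ 2 + y) `^ (p / 2) - 4 * y `^ (p / 2) + p * ((x ^+ 2 + y) `^ (p / 2 - 1) * x).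
Proof.
move=> p12 y0; have /andP[p1 p2] := p12.
set N := x ^+ 2 + y => N1; have x0 : 0 <= x ^+ 2 by exact: sqr_ge0.
have yN : y <= N by rewrite /N; lra.
have y1 : 0 <= y <= 1 by lra.
have := @powR_gap_ge R p y p12 y1.
have : ((x + 1) ^+ 2 + (y + 1)) `^ (p / 2) <= 1 + p / 2 * (N + 2 * x + 1).
  have N'0 : 0 <= (x + 1) ^+ 2 + (y + 1) by rewrite addr_ge0 ?sqr_ge0 //; lra.
  have := @powR_tangent_le R 1 _ (p / 2) ltr01 N'0; rewrite !powR1 mulr1.
  move=> /(_ ltac:(lra)) /le_trans; apply; rewrite /N; lra.
suff : p / 2 * N + p * x - N `^ (p / 2) - p * (N `^ (p / 2 - 1) * x) <= p - y by lra.
have N0 : 0 <= N by lra.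
move: N0; rewrite le_eqVlt => /predU1P[N0|N0].
  have x00 : x = 0 by apply/eqP; rewrite -sqrf_eq0; apply/eqP; move: (N0); rewrite /N; lra.
  rewrite -N0 x00 !mulr0 powR0; last by lra.
  lra.
have Np : N <= N `^ (p / 2) by rewrite ger1_powR //; lra.
have Nm : 1 <= N `^ (p / 2 - 1).
  by rewrite -[leLHS](powRr0 N) ger_powR //; lra.
have pN : p / 2 * N <= N by rewrite ler_piMl //; lra.
have [xp|xn] := leP 0 x.
  have : p * x <= p * (N `^ (p / 2 - 1) * x) by rewrite ler_wpM2l ?ler_peMl //; lra.
  lra.
have rN : N `^ (p / 2 - 1) * Num.sqrt N <= 1.
  rewrite -powR12_sqrt ?(ltW N0) // -powRD ?(gt_eqF N0) ?implybT //.
  by rewrite -[leRHS](powRr0 N) ger_powR //; lra.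
have xr : - x <= Num.sqrt N * (1 - y / 2).
  have rr : (Num.sqrt N) ^+ 2 = N by rewrite sqr_sqrtr // ltW.
  rewrite -ler_sqr ?nnegrE ?mulr_ge0 ?sqrtr_ge0 //; [|lra..].
  rewrite exprMn rr sqrrN; rewrite /N in N1 *; nra.
have : N `^ (p / 2 - 1) * - x <= 1 - y / 2.
  apply: le_trans (_ : _ <= (N `^ (p / 2 - 1) * Num.sqrt N) * (1 - y / 2)) _.
    by rewrite -mulrA ler_wpM2l // powR_ge0.
  by rewrite ler_piMl //; lra.
nra.
Qed.

(** The potential [V(x, y) = (x^2 + y)^(p/2) - 4 y^(p/2)] satisfies
    [V(x + d, y + d^2) <= V(x, y) + d * p N^(p/2-1) x] with [N = x^2 + y].
    If [d^2 <= N], concavity of the power at [N] leaves the error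
    [p N^(p/2-1) d^2], and the second term of the potential absorbs it since
    [y + d^2 <= 2 N].  If [d^2 > N], homogeneity reduces the claim to
    [square_step_normalized]. *)
Lemma square_step {R : realType} (p x y d : R) : 1 < p < 2 -> 0 <= y ->
  ((x + d) ^+ 2 + (y + d ^+ 2)) `^ (p / 2) - 4 * (y + d ^+ 2) `^ (p / 2)
  <= (x ^+ 2 + y) `^ (p / 2) - 4 * y `^ (p / 2) + p * ((x ^+ 2 + y) `^ (p / 2 - 1) * x) * d.
Proof.
move=> p12 y0; have /andP[p1 p2] := p12.
set N := x ^+ 2 + y; have x0 : 0 <= x ^+ 2 by exact: sqr_ge0.
have d0 : 0 <= d ^+ 2 by exact: sqr_ge0.
have [->|dn] := eqVneq d 0; first by rewrite expr0n mulr0 !addr0.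
have dp : 0 < d ^+ 2 by rewrite lt_def d0 sqrf_eq0 dn.
have [dN|Nd] := leP (d ^+ 2) N.
  have N0 : 0 < N by lra.
  have N'0 : 0 <= (x + d) ^+ 2 + (y + d ^+ 2) by rewrite addr_ge0 ?sqr_ge0 //; lra.
  have := @powR_tangent_le R N _ (p / 2) N0 N'0 ltac:(lra).
  have ye : 0 < y + d ^+ 2 by lra.
  have yN : y <= N by rewrite /N; lra.
  have := @powR_tangent_le R _ y (p / 2) ye y0 ltac:(lra).
  have : N `^ (p / 2 - 1) <= 2 * (y + d ^+ 2) `^ (p / 2 - 1).
    apply: le_trans (_ : _ <= 2 * (2 * N) `^ (p / 2 - 1)) _.
      rewrite powRM //; last exact: ltW.
      rewrite mulrA ler_peMl ?powR_ge0 //.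
      rewrite -ler_pdivrMl // mulr1 -[leLHS]powR_inv1 // ler_powR //; lra.
    rewrite ler_pM2l // -[p / 2 - 1]opprB !powRN lef_pV2 ?posrE ?powR_gt0 ?mulr_gt0 //.
    by rewrite ge0_ler_powR ?nnegrE; lra.
  move=> /(ler_wpM2l d0) A B C.
  have {A} : p / 2 * (d ^+ 2 * N `^ (p / 2 - 1))
      <= p / 2 * (d ^+ 2 * (2 * (y + d ^+ 2) `^ (p / 2 - 1))).
    by rewrite ler_wpM2l //; lra.
  have NE : (x + d) ^+ 2 + (y + d ^+ 2) = N + 2 * x * d + 2 * d ^+ 2 by rewrite /N; ring.
  rewrite NE in C *.
  lra.
have := @square_step_normalized R p (x / d) (y / d ^+ 2) p12.
rewrite divr_ge0 // => /(_ erefl).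
have -> : (x / d) ^+ 2 + y / d ^+ 2 = N / d ^+ 2 by rewrite /N; field.
have -> : (x / d + 1) ^+ 2 + (y / d ^+ 2 + 1) = ((x + d) ^+ 2 + (y + d ^+ 2)) / d ^+ 2 by field.
have -> : y / d ^+ 2 + 1 = (y + d ^+ 2) / d ^+ 2 by field.
rewrite ltr_pdivrMr // mul1r => /(_ Nd).
have N0 : 0 <= N by rewrite addr_ge0.
have N'0 : 0 <= (x + d) ^+ 2 + (y + d ^+ 2) by rewrite !addr_ge0 // sqr_ge0.
rewrite !powRM ?invr_ge0 ?addr_ge0 ?sqr_ge0 //.
have ep : 0 < (d ^+ 2) `^ (p / 2) by exact: powR_gt0.
move=> /(ler_wpM2l (ltW ep)).
have E1 : (d ^+ 2) `^ (p / 2) * (d ^+ 2)^-1 `^ (p / 2) = 1.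
  by rewrite -powRM ?invr_ge0 // divff ?powR1 // gt_eqF.
have E2 : (d ^+ 2) `^ (p / 2) * ((d ^+ 2)^-1 `^ (p / 2 - 1) / d) = d.
  rewrite mulrA -[(d ^+ 2)^-1]powR_inv1 // -powRrM -powRD ?(gt_eqF dp) ?implybT //.
  rewrite (_ : p / 2 + -1 * (p / 2 - 1) = 1); last by ring.
  by rewrite powRr1 //; field.
set A := _ `^ (p / 2) in E1 *; set B := _^-1 `^ (p / 2) in E1 *.
set C := _^-1 `^ (p / 2 - 1) in E2 *.
set U := _ `^ (p / 2); set V := _ `^ (p / 2); set W := _ `^ (p / 2); set Y := _ `^ (p / 2).
set Z := _ `^ (p / 2 - 1).
have -> : A * (U * B - 4 * (V * B)) = A * B * (U - 4 * V) by ring.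
have -> : A * (W * B - 4 * (Y * B) + p * (Z * C * (x / d)))
  = A * B * (W - 4 * Y) + p * (Z * x) * (A * (C / d)) by ring.
by rewrite E1 E2 !mul1r.
Qed.

(** * Pathwise inequalities *)

(** [running_max] along one path; the two are convertible. *)
Definition max_abs {R : realType} (x : nat -> R) (n : nat) : R :=
  \big[Num.max/0]_(1 <= j < n.+1) `|x j|.

Definition quad_var {R : realType} (x : nat -> R) (n : nat) : R :=
  \sum_(0 <= k < n) (x k.+1 - x k) ^+ 2.

(** The discrete stochastic integral of [z] with respect to [x]. *)
Definition transform {R : realType} (z x : nat -> R) (n : nat) : R :=
  \sum_(0 <= k < n) z k * (x k.+1 - x k).

Lemma transformD {R : realType} (z1 z2 x : nat -> R) n :
  transform (fun k => z1 k + z2 k) x n = transform z1 x n + transform z2 x n.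
Proof. by rewrite /transform -big_split /=; apply: eq_bigr => i _; rewrite mulrDl. Qed.

Lemma transformZ {R : realType} (c : R) (z x : nat -> R) n :
  transform (fun k => c * z k) x n = c * transform z x n.
Proof. by rewrite /transform mulr_sumr; apply: eq_bigr => i _; rewrite mulrA. Qed.

Lemma transformS {R : realType} (z x : nat -> R) n :
  transform z x n.+1 = transform z x n + z n * (x n.+1 - x n).
Proof. by rewrite /transform big_nat_recr. Qed.

(** The real numbers have no least element, so the iterated maximum with base
    value 0 is not a monoid operation and the recursion needs a proof. *)
Lemma max_absS {R : realType} (x : nat -> R) n :
  max_abs x n.+1 = Num.max (max_abs x n) `|x n.+1|.
Proof.
have in_range k : (k \in index_iota 1 n.+2) = (k \in index_iota 1 n.+1) || (k == n.+1).
  by rewrite !mem_index_iota; case: ltngtP; lia.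
apply/le_anti/andP; split.
  rewrite /max_abs big_seq; apply: bigmax_le; first by rewrite le_max bigmax_ge_id.
  move=> k; rewrite in_range le_max => /orP[kn|/eqP->]; last by rewrite lexx orbT.
  by rewrite (le_bigmax_seq 0 k xpredT (fun j => `|x j|)).
rewrite ge_max; apply/andP; split; first exact: le_bigmax_nat.
by apply: (le_bigmax_seq 0 _ xpredT (fun j => `|x j|)) => //; rewrite in_range eqxx orbT.
Qed.

Lemma max_abs0 {R : realType} (x : nat -> R) : max_abs x 0 = 0.
Proof. by rewrite /max_abs big_geq. Qed.

Lemma max_abs_ge0 {R : realType} (x : nat -> R) n : 0 <= max_abs x n.
Proof. by elim: n => [|n IH]; rewrite ?max_abs0 // max_absS le_max IH. Qed.

Lemma max_abs_le {R : realType} (x : nat -> R) {k n : nat} : (k <= n)%N ->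
  max_abs x k <= max_abs x n.
Proof.
move=> /subnK <-; elim: (n - k)%N => [//|i IH].
by rewrite addSn max_absS le_max IH.
Qed.

Lemma normr_le_max_abs {R : realType} {x : nat -> R} {k n : nat} : x 0%N = 0 ->
  (k <= n)%N -> `|x k| <= max_abs x n.
Proof.
move=> x0 kn; apply: le_trans (max_abs_le x kn); case: k {kn} => [|k].
  by rewrite x0 normr0 max_abs0.
by rewrite max_absS le_max lexx orbT.
Qed.

Lemma quad_varS {R : realType} (x : nat -> R) n :
  quad_var x n.+1 = quad_var x n + (x n.+1 - x n) ^+ 2.
Proof. by rewrite /quad_var big_nat_recr. Qed.

Lemma quad_var0 {R : realType} (x : nat -> R) : quad_var x 0 = 0.
Proof. by rewrite /quad_var big_geq. Qed.

Lemma quad_var_ge0 {R : realType} (x : nat -> R) n : 0 <= quad_var x n.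
Proof. by apply: sumr_ge0 => i _; exact: sqr_ge0. Qed.

Lemma quad_var_le {R : realType} (x : nat -> R) {k n : nat} : (k <= n)%N ->
  quad_var x k <= quad_var x n.
Proof.
move=> /subnK <-; elim: (n - k)%N => [//|i IH].
by rewrite addSn quad_varS (le_trans IH) // lerDl sqr_ge0.
Qed.

Lemma sqrt_quad_var_powR {R : realType} (x : nat -> R) n (p : R) :
  Num.sqrt (quad_var x n) `^ p = quad_var x n `^ (p / 2).
Proof. by rewrite -powR_half_sqr ?sqrtr_ge0 // sqr_sqrtr // quad_var_ge0. Qed.

Lemma normr_increment_le_sqrt_quad_var {R : realType} (x : nat -> R) {k n : nat} :
  (k < n)%N -> `|x k.+1 - x k| <= Num.sqrt (quad_var x n).
Proof.
move=> kn; rewrite -sqrtr_sqr ler_wsqrtr // (le_trans _ (quad_var_le x kn)) //.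
by rewrite quad_varS lerDr quad_var_ge0.
Qed.

Lemma normr_increment_le_max_abs {R : realType} (x : nat -> R) {k n : nat} : x 0%N = 0 ->
  (k < n)%N -> `|x k.+1 - x k| <= 2 * max_abs x n.
Proof.
move=> x0 kn; apply: le_trans (ler_normB _ _) _.
have := @normr_le_max_abs R x k.+1 n x0 kn.
have := @normr_le_max_abs R x k n x0 (ltnW kn); lra.
Qed.

Lemma max_abs_le_quad_var {R : realType} (x : nat -> R) {k n : nat} : x 0%N = 0 ->
  (k <= n)%N -> max_abs x k <= n%:R * Num.sqrt (quad_var x n).
Proof.
move=> x0 kn; set S := Num.sqrt _; have S0 : 0 <= S by exact: sqrtr_ge0.
suff H : `|x k| <= k%:R * S /\ max_abs x k <= k%:R * S.
  by apply: le_trans H.2 _; rewrite ler_wpM2r // ler_nat.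
elim: k kn => [|k IH] kn; first by rewrite x0 normr0 max_abs0 mul0r.
have [H1 H2] := IH (ltnW kn).
have xk : `|x k.+1| <= k.+1%:R * S.
  rewrite -[x k.+1](subrK (x k)) (le_trans (ler_normD _ _)) //.
  have := @normr_increment_le_sqrt_quad_var R x k n kn; rewrite -/S.
  by rewrite -natr1; lra.
split=> //; rewrite max_absS ge_max xk andbT (le_trans H2) // ler_wpM2r //.
by rewrite ler_nat.
Qed.

Lemma quad_var_le_max_abs {R : realType} (x : nat -> R) {k n : nat} : x 0%N = 0 ->
  (k <= n)%N -> quad_var x k <= 4 * n%:R * max_abs x n ^+ 2.
Proof.
move=> x0 kn; apply: le_trans (quad_var_le x kn) _.
rewrite /quad_var; apply: le_trans (_ : _ <= \sum_(0 <= k < n) 4 * max_abs x n ^+ 2) _.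
  apply: ler_sum_nat => i /andP[_ ni].
  have -> : 4 * max_abs x n ^+ 2 = (2 * max_abs x n) ^+ 2 by ring.
  rewrite -(ger0_norm (sqr_ge0 _)) normrX ler_sqr ?nnegrE ?mulr_ge0 ?max_abs_ge0 //.
  exact: normr_increment_le_max_abs.
by rewrite sumr_const_nat subn0 -[_ *+ n]mulr_natr mulrAC.
Qed.

(** Induction shows that the transform of [x] by [M^(p-1) sg x] is at most
    [M^(p-1) |x n| - (p - 1) / p * M^p]: nothing happens to [M] unless it is
    attained by the new term, and then the step is an instance of Young's
    inequality.  A second use of Young trades [M^(p-1) |x n|] for [|x n|^p]. *)
Lemma doob_path {R : realType} (p : R) (x : nat -> R) n : 1 < p -> x 0%N = 0 ->
  max_abs x n `^ p <= (p / (p - 1)) `^ p * `|x n| `^ p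
    - p * (p / (p - 1)) * transform (fun k => max_abs x k `^ (p - 1) * Num.sg (x k)) x n.
Proof.
move=> p1 x0; set W := transform _ x n; set q := p / (p - 1).
have p0 : 0 < p by lra.
have q0 : 0 < q by rewrite divr_gt0 // subr_gt0.
have pp : 0 < p - 1 by lra.
have H : p * W <= p * (max_abs x n `^ (p - 1) * `|x n|) - (p - 1) * max_abs x n `^ p.
  rewrite /W; elim: n {W} => [|n IH].
    rewrite /transform big_geq // x0 max_abs0 normr0 powR0 ?gt_eqF //.
    by rewrite powR0 ?gt_eqF // !(mulr0, mul0r) subr0.
  rewrite transformS; set m := max_abs x n in IH *; set a := `|x n| in IH *.
  set m' := max_abs x n.+1; set a' := `|x n.+1|.
  have m0 : 0 <= m by exact: max_abs_ge0.
  have mp0 : 0 <= m `^ (p - 1) by exact: powR_ge0.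
  have sg : Num.sg (x n) * (x n.+1 - x n) <= a' - a.
    rewrite mulrBr -normrEsg -/a lerD2r -[a']mul1r (le_trans (ler_norm _)) //.
    by rewrite normrM ler_wpM2r // normr_sg lern1 leq_b1.
  have {sg} := ler_wpM2l mp0 sg; rewrite mulrA => /(ler_wpM2l (ltW p0)) sg.
  rewrite mulrDr; apply: le_trans (lerD IH sg) _.
  apply: le_trans (_ : _ <= p * (m `^ (p - 1) * a') - (p - 1) * m `^ p) _; first by lra.
  have [am|/ltW ma] := leP a' m.
    by have -> : m' = m by rewrite /m' max_absS; apply/max_idPl.
  have -> : m' = a' by rewrite /m' max_absS; apply/max_idPr.
  have a'0 : 0 <= a' by exact: normr_ge0.
  rewrite powRB1K //.
  by have := @powR_young R m a' p m0 a'0 (ltW p1); lra.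
have qa0 : 0 <= q * `|x n| by rewrite mulr_ge0 // ltW.
have := @powR_young R (max_abs x n) (q * `|x n|) p (max_abs_ge0 x n) qa0 (ltW p1).
rewrite powRM ?normr_ge0 // ?(ltW q0) // => Y.
move: H => /(ler_wpM2l (ltW q0)).
have -> : q * (p * (max_abs x n `^ (p - 1) * `|x n|) - (p - 1) * max_abs x n `^ p)
  = p * (max_abs x n `^ (p - 1) * (q * `|x n|)) - p * max_abs x n `^ p.
  by rewrite /q; field; lra.
lra.
Qed.

(** Sum of the Taylor bounds, all with the final maximum as [m]; a later maximum
    may be used there since no measurability is involved. *)
Lemma taylor_path_le {R : realType} (p : R) (x : nat -> R) n : 2 <= p -> x 0%N = 0 ->
  `|x n| `^ p <= p * (p - 1) / 2 * (max_abs x n `^ (p - 2) * quad_var x n)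
                 + transform (fun k => dpow p (x k)) x n.
Proof.
move=> p2 x0; suff H k : (k <= n)%N -> `|x k| `^ p <=
    p * (p - 1) / 2 * (max_abs x n `^ (p - 2) * quad_var x k)
    + transform (fun k => dpow p (x k)) x k by exact: H.
elim: k => [|k IH] kn.
  rewrite x0 normr0 powR0; last by lra.
  by rewrite quad_var0 /transform big_geq // !mulr0 addr0.
rewrite quad_varS transformS.
have := @taylor_powR_le R p (max_abs x n) (x k) (x k.+1) p2
  (normr_le_max_abs x0 (ltnW kn)) (normr_le_max_abs x0 kn).
have := IH (ltnW kn); lra.
Qed.

Lemma taylor_path_ge {R : realType} (p : R) (x : nat -> R) n : 1 < p <= 2 -> x 0%N = 0 ->
  p * (p - 1) / 2 * (max_abs x n `^ (p - 2) * quad_var x n)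
    + transform (fun k => dpow p (x k)) x n <= `|x n| `^ p.
Proof.
move=> p12 x0; suff H k : (k <= n)%N -> 
    p * (p - 1) / 2 * (max_abs x n `^ (p - 2) * quad_var x k)
    + transform (fun k => dpow p (x k)) x k <= `|x k| `^ p by exact: H.
elim: k => [|k IH] kn.
  rewrite x0 normr0 powR0; last by lra.
  by rewrite quad_var0 /transform big_geq // !mulr0 addr0.
rewrite quad_varS transformS.
have := @taylor_powR_ge R p (max_abs x n) (x k) (x k.+1) p12
  (normr_le_max_abs x0 (ltnW kn)) (normr_le_max_abs x0 kn).
have := IH (ltnW kn); lra.
Qed.

(** Sum of the inequalities [square_step], where [V(0, 0) = 0]. *)
Lemma square_path {R : realType} (p : R) (x : nat -> R) n : 1 < p < 2 -> x 0%N = 0 ->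
  `|x n| `^ p <= 4 * quad_var x n `^ (p / 2)
    + p * transform (fun k => (x k ^+ 2 + quad_var x k) `^ (p / 2 - 1) * x k) x n.
Proof.
move=> p12 x0.
suff H : (x n ^+ 2 + quad_var x n) `^ (p / 2) <= 4 * quad_var x n `^ (p / 2)
    + p * transform (fun k => (x k ^+ 2 + quad_var x k) `^ (p / 2 - 1) * x k) x n.
  apply: le_trans H; rewrite -powR_half_sqr // -normrX (ger0_norm (sqr_ge0 _)).
  rewrite ge0_ler_powR ?nnegrE ?addr_ge0 ?sqr_ge0 ?quad_var_ge0 //; first by lra.
  by rewrite lerDl quad_var_ge0.
elim: n => [|n IH].
  rewrite x0 quad_var0 expr0n addr0 /transform big_geq // mulr0 addr0 powR0 ?mulr0 //.
  by lra.
rewrite quad_varS transformS.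
have := @square_step R p (x n) (quad_var x n) (x n.+1 - x n) p12 (quad_var_ge0 x n).
rewrite (addrC (x n) (_ - _)) subrK; lra.
Qed.

(** Put [y_k] for the quadratic variation, [b_k = y_k^(r-1)] and [m] for the final
    maximum.  By convexity [y_k^r] grows at most by [r b_k (x_k - x_(k-1))^2],
    where [b_k] is not yet known at time [k - 1].  Replacing it by [b_(k-1)]
    leaves [x_k^2 - x_(k-1)^2] up to a transform, while the difference
    [b_k - b_(k-1)] is multiplied by [(x_k - x_(k-1))^2 <= 3 m^2 + x_k^2].
    Hence the bound [r (3 m^2 + x_k^2) b_k] propagates; at the end it is at most
    [4 r m^2 b_n], and Young's inequality separates the factors. *)
Lemma garsia_path {R : realType} (r : R) (x : nat -> R) n : 1 < r -> x 0%N = 0 ->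
  quad_var x n `^ r <= (4 * r * max_abs x n ^+ 2) `^ r
    - 2 * r ^+ 2 * transform (fun k => quad_var x k `^ (r - 1) * x k) x n.
Proof.
move=> r1 x0; set m := max_abs x n; have m0 : 0 <= m by exact: max_abs_ge0.
pose W := transform (fun k => quad_var x k `^ (r - 1) * x k) x.
have H k : (k <= n)%N -> quad_var x k `^ r + 2 * r * W k
    <= r * ((3 * m ^+ 2 + x k ^+ 2) * quad_var x k `^ (r - 1)).
  elim: k => [|k IH] kn.
    rewrite quad_var0 /W /transform big_geq // !powR0; [|lra..].
    by rewrite !mulr0 addr0.
  have {IH} := IH (ltnW kn); rewrite /W transformS.
  set s := quad_var x k; set s' := quad_var x k.+1.
  have s's : s' = s + (x k.+1 - x k) ^+ 2 by exact: quad_varS.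
  have s0 : 0 <= s by exact: quad_var_ge0.
  have s'0 : 0 <= s' by exact: quad_var_ge0.
  have := @powR_tangent_ge R s' s r s'0 s0 (ltW r1).
  have : s `^ (r - 1) <= s' `^ (r - 1).
    by rewrite ge0_ler_powR ?nnegrE //; [lra | exact: quad_var_le].
  have := @normr_le_max_abs R x _ _ x0 kn.
  have := @normr_le_max_abs R x _ _ x0 (ltnW kn).
  rewrite -/m !ler_norml => /andP[xm1 xm2] /andP[xm3 xm4].
  set b := s `^ (r - 1); set b' := s' `^ (r - 1) => bb.
  have -> : s - s' = - (x k.+1 - x k) ^+ 2 by rewrite s's; ring.
  have key : (b' - b) * (x k.+1 - x k) ^+ 2 <= (b' - b) * (3 * m ^+ 2 + x k.+1 ^+ 2).
    by rewrite ler_wpM2l ?subr_ge0 //; nra.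
  have {key} := ler_wpM2l (ltW (lt_trans ltr01 r1)) key; lra.
have {H} := H n (leqnn n).
have xm : x n ^+ 2 <= m ^+ 2.
  by rewrite -(ger0_norm (sqr_ge0 _)) normrX ler_sqr ?nnegrE // normr_le_max_abs.
have s0 := quad_var_ge0 x n; set s := quad_var x n in s0 * => H.
have b0 : 0 <= s `^ (r - 1) by exact: powR_ge0.
have r0 : 0 < r by lra.
have {}H : s `^ r + 2 * r * W n <= s `^ (r - 1) * (4 * r * m ^+ 2).
  apply: le_trans H _; rewrite (_ : s `^ _ * _ = r * ((4 * m ^+ 2) * s `^ (r - 1))); last by ring.
  by rewrite ler_pM2l // ler_wpM2r //; lra.
have := @powR_young R s (4 * r * m ^+ 2) r s0.
rewrite !mulr_ge0 ?sqr_ge0 ?(ltW r0) ?(ltW r1) // => /(_ erefl erefl).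
have := ler_wpM2l (ltW r0) H; rewrite /W; lra.
Qed.

(** * Martingale transforms have mean zero *)

Lemma measurable_wrt_measurable {d} {T : measurableType d} {R : realType}
    {G : set (set T)} {Y : T -> R} : sigma_algebra setT G -> G `<=` measurable ->
  measurable_wrt G Y -> measurable_fun setT Y.
Proof.
move=> sG Gm mY _ B mB; apply: Gm.
have := mY measurableT B mB.
by rewrite [X in X -> _](_ : _ = <<s G >> (setT `&` Y @^-1` B)) // sigma_algebra_id.
Qed.

Lemma integral_mul_indic {d} {T : measurableType d} {R : realType}
    (P : probability T R) (A : set T) (D : T -> R) :
  (\int[P]_w (\1_A w * D w)%:E = \int[P]_(w in A) (D w)%:E)%E.
Proof.
rewrite [RHS]integral_mkcond; apply: eq_integral => w _.
rewrite patchE indicE; case: (w \in A); first by rewrite mul1r.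
by rewrite mul0r.
Qed.

Import HBNNSimple.

(** The approximation by simple functions in terms of plain functions and sets.
    It is applied to a sub-sigma-algebra but used with the ambient one, and
    bundled simple functions would be tied to a single measurable structure. *)
Lemma ge0_simple_approx {d} {T : measurableType d} {R : realType} (f : T -> R) :
  measurable_fun setT f -> (forall w, 0 <= f w) ->
  exists h : nat -> T -> R,
    [/\ forall n, exists m (c : nat -> R) (A : nat -> set T),
          (forall i, measurable (A i)) /\
          (forall w, h n w = \sum_(i < m) c i * \1_(A i) w),
        forall n w, 0 <= h n w <= f w &
        forall w, (h n w)%:E @[n --> \oo] --> (f w)%:E].
Proof.
move=> mf f0; have mf' : measurable_fun setT (EFin \o f) by apply/measurable_EFinP.
pose h := nnsfun_approx measurableT mf'.
have hf w : (h n w)%:E @[n --> \oo] --> (f w)%:E.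
  by apply: (@cvg_nnsfun_approx _ T R setT measurableT _ mf') => // x _; rewrite lee_fin.
exists (fun n => h n); split => [n|n w|//].
- set s := finmap.enum_fset (fset_set (h n @` setT)).
  exists (size s), (fun i => s`_i), (fun i => h n @^-1` [set s`_i]); split => // w.
  exact: (fimfunEord (h n)).
- apply/andP; split => //.
  have hfw : h n w @[n --> \oo] --> f w by exact: (fine_cvg (hf w)).
  have nd : nondecreasing_seq (fun n => h n w).
    by move=> i j ij; apply/lefP; exact: nd_nnsfun_approx.
  by rewrite -(cvg_lim _ hfw) //; apply: nondecreasing_cvgn_le nd _ n; apply/cvg_ex; exists (f w).
Qed.

(** Indicators of sets in [G] are covered by the hypothesis, simple functions by
    linearity, and [Z] by dominated convergence with bound [|Z * D|]. *)
Lemma integral_mul_eq0_ge0 {d} {T : measurableType d} {R : realType}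
    (P : probability T R) (G : set (set T)) (Z D : T -> R) :
  sigma_algebra setT G -> G `<=` measurable ->
  P.-integrable setT (EFin \o D) ->
  (forall A, G A -> \int[P]_(w in A) (D w)%:E = 0)%E ->
  measurable_wrt G Z -> (forall w, 0 <= Z w) ->
  P.-integrable setT (fun w => (Z w * D w)%:E) ->
  (\int[P]_w (Z w * D w)%:E = 0)%E.
Proof.
move=> sG Gm iD D0 mZ Z0 iZD.
have [h [hE hZ cvh]] := @ge0_simple_approx _ (g_sigma_algebraType G) R Z mZ Z0.
have mD : measurable_fun setT D by apply/measurable_EFinP/(measurable_int _ iD).
have {}hE n : measurable_fun setT (h n : T -> R) /\ (\int[P]_w (h n w * D w)%:E = 0)%E.
  have [m [c [A [mA hA]]]] := hE n.
  have GA i : G (A i) by rewrite -(sigma_algebra_id sG); exact: mA.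
  have iA i : P.-integrable setT (fun w => (\1_(A i) w * D w)%:E).
    apply: le_integrable iD => //.
      apply/measurable_EFinP/measurable_funM => //; apply/measurable_indic.
      exact: Gm.
    move=> w _ /=; rewrite lee_fin normrM indicE; case: (w \in _) => /=.
      by rewrite normr1 mul1r.
    by rewrite normr0 mul0r.
  split.
    rewrite (_ : h n = fun w => \sum_(i < m) c i * \1_(A i) w); last exact/funext.
    apply: measurable_sum => i; apply: measurable_funM => //.
    by apply/measurable_indic/Gm.
  under eq_integral => w _ do rewrite hA mulr_suml -sumEFin.
  rewrite integral_sum //.
    apply: big1 => i _; under eq_integral => w _ do rewrite -mulrA EFinM.
    by rewrite integralZl // integral_mul_indic D0 ?mule0.
  move=> i; under eq_fun do rewrite -mulrA EFinM.
  exact: integrableZl.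
have [] := @dominated_convergence _ _ _ P setT measurableT (fun n w => (h n w * D w)%:E)
  (fun w => (Z w * D w)%:E) (fun w => `|(Z w * D w)%:E|%E).
- by move=> n; apply/measurable_EFinP/measurable_funM => //; exact: (hE n).1.
- exact: measurable_int iZD.
- apply/aeW => w _.
  have : (fun n => (h n w)%:E * (D w)%:E)%E @ \oo --> ((Z w)%:E * (D w)%:E)%E.
    by apply: cvgeZr => //; exact: cvh.
  exact.
- exact: integrable_abse.
- apply/aeW => w n _; rewrite lee_fin !normrM ler_wpM2r //.
  by have /andP[h0 hz] := hZ n w; rewrite !ger0_norm.
move=> _ _ H; apply: (cvg_unique _ H); first exact: ereal_hausdorff.
have -> : [sequence (\int[P]_w (h n w * D w)%:E)%E]_n = (fun=> 0%E).
  by apply/funext => n; exact: (hE n).2.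
exact: cvg_cst.
Qed.

Lemma integral_mul_eq0 {d} {T : measurableType d} {R : realType}
    (P : probability T R) (G : set (set T)) (Z D : T -> R) :
  sigma_algebra setT G -> G `<=` measurable ->
  P.-integrable setT (EFin \o D) ->
  (forall A, G A -> \int[P]_(w in A) (D w)%:E = 0)%E ->
  measurable_wrt G Z ->
  P.-integrable setT (fun w => (Z w * D w)%:E) ->
  (\int[P]_w (Z w * D w)%:E = 0)%E.
Proof.
move=> sG Gm iD D0 mZ iZD.
pose Zp w := Num.max (Z w) 0; pose Zn w := Num.max (- Z w) 0.
have mZp : measurable_wrt G Zp by exact: measurable_maxr.
have mZn : measurable_wrt G Zn.
  by apply: measurable_maxr => //; exact: measurable_funN.
have ZE w : Z w = Zp w - Zn w.
  by rewrite /Zp /Zn !maxEle; have [?|?] := leP (Z w) 0; have [?|?] := leP (- Z w) 0; lra.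
have mD : measurable_fun setT D by apply/measurable_EFinP/(measurable_int _ iD).
have sub Y : measurable_wrt G Y -> (forall w, `|Y w| <= `|Z w|) ->
    P.-integrable setT (fun w => (Y w * D w)%:E).
  move=> mY YZ; apply: le_integrable iZD => //.
    apply/measurable_EFinP/measurable_funM => //.
    exact: (@measurable_wrt_measurable _ _ _ G).
  by move=> w _ /=; rewrite lee_fin !normrM ler_wpM2r.
have iZp : P.-integrable setT (fun w => (Zp w * D w)%:E).
  apply: sub => // w; rewrite /Zp maxEle; case: (Z w <= 0) => //.
  by rewrite normr0.
have iZn : P.-integrable setT (fun w => (Zn w * D w)%:E).
  apply: sub => // w; rewrite /Zn maxEle; case: (- Z w <= 0); last by rewrite normrN.
  by rewrite normr0.
under eq_integral => w _ do rewrite ZE mulrBl EFinB.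
rewrite integralB //.
rewrite !(@integral_mul_eq0_ge0 _ _ _ _ G) ?sube0 // => w.
  by rewrite le_max lexx orbT.
by rewrite le_max lexx orbT.
Qed.

Lemma filtration_subset {d} {T : measurableType d} {F : nat -> set (set T)} {j k : nat} :
  filtration F -> (1 <= j)%N -> (j <= k)%N -> F j `<=` F k.
Proof.
move=> fF j1 /subnK <-; elim: (k - j)%N => [//|i IH].
apply: subset_trans IH _; rewrite addSn.
by have [] := fF (i + j)%N (leq_trans j1 (leq_addl i j)).
Qed.

Lemma martingale_adapted {d} {T : measurableType d} {R : realType}
    {P : probability T R} {F : nat -> set (set T)} {X : nat -> T -> R} {j k : nat} :
  filtration F -> martingale P F X -> (1 <= j)%N -> (j <= k)%N ->
  measurable_wrt (F k) (X j).
Proof.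
move=> fF mX j1 jk _ B mB; have [mXj _ _] := mX j j1.
have := mXj measurableT B mB; apply: sub_sigma_algebra2.
exact: filtration_subset.
Qed.

Lemma martingale_measurable {d} {T : measurableType d} {R : realType}
    {P : probability T R} {F : nat -> set (set T)} {X : nat -> T -> R} {j : nat} :
  filtration F -> martingale P F X -> (forall w, X 0%N w = 0) ->
  measurable_fun setT (X j).
Proof.
move=> fF mX X0; case: j => [|j].
  by rewrite (_ : X 0%N = cst 0) //; exact/funext.
have [sF Fm _] := fF j.+1 isT.
by apply: measurable_wrt_measurable sF Fm _; apply: martingale_adapted fF mX _ _.
Qed.

Lemma martingale_increment_eq0 {d} {T : measurableType d} {R : realType}
    {P : probability T R} {F : nat -> set (set T)} {X : nat -> T -> R}
    {k : nat} {z : T -> R} :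
  filtration F -> martingale P F X -> (1 <= k)%N -> measurable_wrt (F k) z ->
  P.-integrable setT (fun w => (z w * (X k.+1 w - X k w))%:E) ->
  (\int[P]_w (z w * (X k.+1 w - X k w))%:E = 0)%E.
Proof.
move=> fF mX k1 mz iz; have [sF Fm _] := fF k k1.
have [_ iX [_ _ condX]] := mX k k1; have [_ iX' _] := mX k.+1 isT.
pose D w := X k.+1 w - X k w.
have iD : P.-integrable setT (EFin \o D).
  rewrite (_ : EFin \o D = (EFin \o X k.+1) \- (EFin \o X k))%E; last by [].
  exact: integrableB.
apply: (@integral_mul_eq0 _ _ _ _ (F k) z D) => //.
move=> A FA; have mA := Fm _ FA.
have iXA : P.-integrable A (EFin \o X k) by exact: integrableS iX.
have iXA' : P.-integrable A (EFin \o X k.+1) by exact: integrableS iX'.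
under eq_integral => w _ do rewrite EFinB.
by rewrite integralB // -condX // subee // integrable_fin_num.
Qed.

(** The passage from a pathwise inequality to moments.  If [g] has infinite
    integral there is nothing to prove; otherwise every term of the transform
    is integrable with integral 0.  The index 0 is set apart because [F 0] is
    unconstrained: there the weight vanishes. *)
Lemma transform_dominated {d} {T : measurableType d} {R : realType}
    {P : probability T R} {F : nat -> set (set T)} {X : nat -> T -> R}
    (n : nat) (z : nat -> T -> R) (f g : T -> R) (c K : R) :
  filtration F -> martingale P F X -> (forall w, X 0%N w = 0) ->
  measurable_fun setT f -> measurable_fun setT g ->
  (forall w, 0 <= f w) -> (forall w, 0 <= g w) -> 0 < c ->
  (forall w, z 0%N w = 0) ->
  (forall k, (1 <= k)%N -> measurable_wrt (F k) (z k)) ->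
  (forall k w, (k < n)%N -> `|z k w * (X k.+1 w - X k w)| <= K * g w) ->
  (forall w, f w <= c * g w + transform (z ^~ w) (X ^~ w) n) ->
  ('E_P[f] <= c%:E * 'E_P[g])%E.
Proof.
move=> fF mX X0 mf mg f0 g0 c0 z0 mz zK fg; rewrite unlock.
have gE : (0 <= \int[P]_w (g w)%:E)%E by apply: integral_ge0 => w _; rewrite lee_fin.
have [goo|gfin] := eqVneq (\int[P]_w (g w)%:E)%E +oo%E.
  by rewrite goo gt0_muley ?lte_fin // leey.
have ig : P.-integrable setT (EFin \o g).
  apply/integrableP; split; first exact/measurable_EFinP.
  by under eq_integral => w _ do rewrite /= ger0_norm //; rewrite ltey.
pose t k w := z k w * (X k.+1 w - X k w).
have it k : (k < n)%N -> P.-integrable setT (EFin \o t k).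
  move=> kn; apply: le_integrable (integrableZl measurableT K ig) => //.
    apply/measurable_EFinP/measurable_funM; last first.
      by apply: measurable_funB; exact: (martingale_measurable fF mX X0).
    case: k kn => [_|k _].
      by rewrite (_ : z 0%N = cst 0) //; exact/funext.
    have [sF Fm _] := fF k.+1 isT.
    exact: measurable_wrt_measurable sF Fm (mz k.+1 isT).
  by move=> w _ /=; rewrite lee_fin; apply: le_trans (zK k w kn) _; rewrite ler_norm.
(* The terms of index at least [n] are set to 0 because integrability of a sum
   is stated for terms that are all integrable. *)
have it' k : P.-integrable setT (EFin \o (if (k < n)%N then t k else cst 0)).
  case: ifP => [/it //|_]; rewrite (_ : EFin \o cst 0 = cst 0%E) //.
  exact: integrable0.
have E0 k : (k < n)%N -> (\int[P]_w (t k w)%:E = 0)%E.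
  case: k => [_|k kn].
    by apply: integral0_eq => w _; rewrite /t z0 mul0r.
  apply: (martingale_increment_eq0 fF) => //; first exact: mz.
  exact: it.
pose u w : R := \sum_(0 <= k < n) (if (k < n)%N then t k else cst 0) w.
have iu : P.-integrable setT (fun w => (u w)%:E).
  under eq_fun do rewrite -sumEFin.
  by apply: integrable_sum => // k _; exact: it'.
have Eu : (\int[P]_w (u w)%:E = 0)%E.
  under eq_integral => w _ do rewrite -sumEFin.
  rewrite integral_sum //; apply: big1_seq => k /andP[_].
  rewrite mem_index_iota => /andP[_ kn].
  by under eq_integral => w _ do rewrite kn; exact: E0.
have icg : P.-integrable setT (fun w => (c%:E * (g w)%:E)%E) by exact: integrableZl.
rewrite -integralZl // -[leRHS]adde0 -Eu -integralD //.
apply: ge0_le_integral => //.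
- by move=> w _; rewrite lee_fin.
- exact/measurable_EFinP.
- by apply: (measurable_int P); apply: integrableD.
move=> w _; rewrite -EFinM -EFinD lee_fin; apply: le_trans (fg w) _.
rewrite lerD2l /transform /u le_eqVlt; apply/orP; left; apply/eqP.
by apply: eq_big_nat => k /andP[_ kn]; rewrite kn.
Qed.

Lemma sgr_measurable {R : realType} : measurable_fun (setT : set R) (@Num.sg R).
Proof.
apply: nondecreasing_measurable => // x y xy.
case: (sgrP x) => x0; case: (sgrP y) => y0; lra.
Qed.

Lemma sqrtr_measurable {R : realType} : measurable_fun (setT : set R) (@Num.sqrt R).
Proof. by apply: nondecreasing_measurable => // x y; exact: ler_wsqrtr. Qed.

Lemma measurable_powR_comp {d} {T : measurableType d} {R : realType} (f : T -> R) (a : R) :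
  measurable_fun setT f -> measurable_fun setT (fun w => f w `^ a).
Proof. by move=> mf; apply: (measurableT_comp (measurable_powR a)). Qed.

Lemma measurable_max_abs {d} {T : measurableType d} {R : realType} (X : nat -> T -> R) k :
  (forall j, (j <= k)%N -> measurable_fun setT (X j)) ->
  measurable_fun setT (fun w => max_abs (X ^~ w) k).
Proof.
elim: k => [|k IH] mX.
  by under eq_fun do rewrite max_abs0; exact: measurable_cst.
under eq_fun do rewrite max_absS; apply: measurable_maxr.
  by apply: IH => j jk; apply: mX; exact: ltnW.
by apply: measurableT_comp => //; exact: mX.
Qed.

Lemma measurable_quad_var {d} {T : measurableType d} {R : realType} (X : nat -> T -> R) k :
  (forall j, (j <= k)%N -> measurable_fun setT (X j)) ->
  measurable_fun setT (fun w => quad_var (X ^~ w) k).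
Proof.
elim: k => [|k IH] mX.
  by under eq_fun do rewrite quad_var0; exact: measurable_cst.
under eq_fun do rewrite quad_varS; apply: measurable_funD.
  by apply: IH => j jk; apply: mX; exact: ltnW.
by apply: measurable_funX; apply: measurable_funB; exact: mX.
Qed.

Lemma measurable_dpow {R : realType} (p : R) : measurable_fun (setT : set R) (dpow p).
Proof.
apply: measurable_funM => //; apply: measurable_funM; first exact: sgr_measurable.
by apply: measurable_powR_comp; exact: normr_measurable.
Qed.

(** * The four pathwise estimates between maximal and square function *)

(** Write [S^p] as the product of [(S^2 M^(p-2))^(p/2)] and [(M^p)^(1-p/2)].
    The arithmetic-geometric mean inequality, after scaling the first factor by
    [c = 2 / (p (p - 1))], reduces the claim to
    [S^2 M^(p-2) <= c (M^p - ...)], which is [taylor_path_ge]. *)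
Lemma upper_path_le2 {R : realType} (p : R) (x : nat -> R) n : 1 < p <= 2 -> x 0%N = 0 ->
  Num.sqrt (quad_var x n) `^ p <= (2 / (p * (p - 1))) `^ (p / 2) * max_abs x n `^ p
    + transform (fun k => - ((2 / (p * (p - 1))) `^ (p / 2) * (p / 2)) * dpow p (x k)) x n.
Proof.
move=> p12 x0; have /andP[p1 p2] := p12.
have p0 : 0 < p by lra.
rewrite sqrt_quad_var_powR transformZ.
have := @taylor_path_ge R p x n p12 x0.
set W := transform _ _ _; set s := quad_var x n; set m := max_abs x n.
set c := 2 / (p * (p - 1)).
have c0 : 0 < c by rewrite divr_gt0 // mulr_gt0 // subr_gt0.
have -> : p * (p - 1) / 2 = c^-1 by rewrite /c invf_div.
clearbody c.
have m0 : 0 <= m by exact: max_abs_ge0.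
have s0 : 0 <= s by exact: quad_var_ge0.
have xm : `|x n| `^ p <= m `^ p.
  by rewrite ge0_ler_powR ?nnegrE // ?(ltW p0) // normr_le_max_abs.
move=> /le_trans /(_ xm) H.
have ct0 : 0 < c `^ (p / 2) by exact: powR_gt0.
suff E : s `^ (p / 2) <= c `^ (p / 2) * (p / 2 * (c^-1 * (m `^ (p - 2) * s)) + (1 - p / 2) * m `^ p).
  apply: le_trans E _; rewrite [leRHS](_ : _ = c `^ (p / 2) * (m `^ p - p / 2 * W)); last by ring.
  rewrite ler_pM2l //.
  have p20 : 0 <= p / 2 by lra.
  have := ler_wpM2l p20 H; lra.
have [m00|mn0] := eqVneq m 0.
  have -> : s = 0.
    apply/le_anti/andP; split=> //.
    by have := @quad_var_le_max_abs R x n n x0 (leqnn n); rewrite -/m -/s m00 expr0n mulr0.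
  by rewrite m00 !mulr0 add0r !powR0 ?mulr0 // ?gt_eqF // divr_gt0.
have mp : 0 < m by rewrite lt_def mn0.
have t01 : 0 <= p / 2 <= 1 by lra.
have a0 : 0 <= c^-1 * (m `^ (p - 2) * s).
  by rewrite !mulr_ge0 ?powR_ge0 // invr_ge0 ltW.
have := @powR_amgm R _ _ _ a0 (powR_ge0 m p) t01.
rewrite -(ler_pM2l ct0); apply: le_trans.
rewrite !powRM ?mulr_ge0 ?powR_ge0 ?invr_ge0 // ?(ltW c0) // -!powRrM.
have -> : c `^ (p / 2) * (c^-1 `^ (p / 2) * (m `^ ((p - 2) * (p / 2)) * s `^ (p / 2)) * m `^ (p * (1 - p / 2)))
  = (c `^ (p / 2) * c^-1 `^ (p / 2)) * (m `^ ((p - 2) * (p / 2)) * m `^ (p * (1 - p / 2))) * s `^ (p / 2).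
  by ring.
rewrite -powRM ?invr_ge0 ?(ltW c0) // divff ?(gt_eqF c0) // powR1 mul1r.
rewrite -powRD ?mn0 ?implybT // (_ : _ + _ = 0); last by field.
by rewrite powRr0 mul1r.
Qed.

Lemma upper_path_gt2 {R : realType} (p : R) (x : nat -> R) n : 2 < p -> x 0%N = 0 ->
  Num.sqrt (quad_var x n) `^ p <= (2 * p) `^ (p / 2) * max_abs x n `^ p
    + transform (fun k => - (2 * (p / 2) ^+ 2) * (quad_var x k `^ (p / 2 - 1) * x k)) x n.
Proof.
move=> p2 x0; rewrite sqrt_quad_var_powR transformZ.
have r1 : 1 < p / 2 by lra.
have := @garsia_path R (p / 2) x n r1 x0.
rewrite powRM ?sqr_ge0 //; last by lra.
rewrite powR_half_sqr ?max_abs_ge0 // (_ : 4 * (p / 2) = 2 * p); [lra | by field].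
Qed.

(** [doob_path] and [taylor_path_le] bound [M^p] by [L M^(p-2) S^2] up to a
    transform, with [L = q^p p (p - 1) / 2]; Young's inequality with exponent
    [p / 2] removes the power of [M]. *)
Lemma lower_path_ge2 {R : realType} (p : R) (x : nat -> R) n : 2 <= p -> x 0%N = 0 ->
  max_abs x n `^ p <=
    ((p / (p - 1)) `^ p * (p * (p - 1) / 2)) `^ (p / 2) * Num.sqrt (quad_var x n) `^ p
    + transform (fun k => p / 2 * (p / (p - 1)) `^ p * dpow p (x k)
        + - (p / 2 * (p * (p / (p - 1)))) * (max_abs x k `^ (p - 1) * Num.sg (x k))) x n.
Proof.
move=> p2 x0; have p1 : 1 < p by lra.
have p0 : 0 < p by lra.
have pp : 0 < p - 1 by lra.
rewrite sqrt_quad_var_powR transformD (transformZ (p / 2 * _)) (transformZ (- _)).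
have := @doob_path R p x n p1 x0; have := @taylor_path_le R p x n p2 x0.
set V := transform _ _ _; set W := transform _ _ _.
set q := p / (p - 1); set m := max_abs x n; set s := quad_var x n.
have q0 : 0 < q by rewrite divr_gt0.
have qp0 : 0 < q `^ p by exact: powR_gt0.
have m0 : 0 <= m by exact: max_abs_ge0.
have s0 : 0 <= s by exact: quad_var_ge0.
set L := q `^ p * (p * (p - 1) / 2).
have L0 : 0 <= L by rewrite !mulr_ge0 ?(ltW qp0) ?(ltW p0) ?(ltW pp).
rewrite -(powRM _ L0 s0) => T D.
have r1 : 1 <= p / 2 by lra.
have Ls0 : 0 <= L * s by rewrite mulr_ge0.
have := @powR_young R (m ^+ 2) (L * s) (p / 2) (sqr_ge0 m) Ls0 r1.
rewrite powR_half_sqr // (_ : (m ^+ 2) `^ (p / 2 - 1) = m `^ (p - 2)); last first.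
  by rewrite (_ : p / 2 - 1 = (p - 2) / 2); [rewrite powR_half_sqr | by field].
have {T} := ler_wpM2l (ltW qp0) T.
have -> : q `^ p * (p * (p - 1) / 2 * (m `^ (p - 2) * s) + V)
   = m `^ (p - 2) * (L * s) + q `^ p * V by rewrite /L; ring.
move=> T Y.
have r0 : 0 <= p / 2 by lra.
have := ler_wpM2l r0 (le_trans D (lerB T (lexx _))); lra.
Qed.

Lemma lower_path_lt2 {R : realType} (p : R) (x : nat -> R) n : 1 < p < 2 -> x 0%N = 0 ->
  max_abs x n `^ p <= 4 * (p / (p - 1)) `^ p * Num.sqrt (quad_var x n) `^ p
    + transform (fun k => (p / (p - 1)) `^ p * p * ((x k ^+ 2 + quad_var x k) `^ (p / 2 - 1) * x k)
        + - (p * (p / (p - 1))) * (max_abs x k `^ (p - 1) * Num.sg (x k))) x n.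
Proof.
move=> p12 x0; have /andP[p1 p2] := p12.
rewrite sqrt_quad_var_powR transformD !transformZ.
have := @doob_path R p x n p1 x0; have := @square_path R p x n p12 x0.
set V := transform _ _ _; set W := transform _ _ _.
move=> /(ler_wpM2l (powR_ge0 (p / (p - 1)) p)); lra.
Qed.

(** * The constants *)

Lemma upper_const_le2 {R : realType} (p : R) : 1 < p <= 2 ->
  upper_const p `^ p = (2 / (p * (p - 1))) `^ (p / 2).
Proof.
move=> /andP[p1 p2]; rewrite /upper_const.
have pp : 0 < p * (p - 1) / 2 by rewrite divr_gt0 // mulr_gt0; lra.
have [plt|pge] := ltP p 2.
  rewrite -sqrtrV ?(ltW pp) // invf_div -powR_half_sqr ?sqrtr_ge0 // sqr_sqrtr //.
  by rewrite -invf_div invr_ge0 ltW.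
have -> : p = 2 by apply/le_anti; rewrite p2.
rewrite eqxx powR1 (_ : 2 / (2 * (2 - 1)) = 1 :> R) ?powR1 //.
by field.
Qed.

Lemma upper_const_gt2 {R : realType} (p : R) : 2 < p ->
  upper_const p `^ p = (2 * p) `^ (p / 2).
Proof.
move=> p2; rewrite /upper_const ltNge (ltW p2) /= gt_eqF //.
by rewrite -powR_half_sqr ?sqrtr_ge0 // sqr_sqrtr //; lra.
Qed.

(** In fact [lower_const p ^ 2 * L = 1], where [L] is the constant of
    [lower_path_ge2]. *)
Lemma lower_const_ge2 {R : realType} (p : R) : 2 <= p ->
  lower_const p `^ p * ((p / (p - 1)) `^ p * (p * (p - 1) / 2)) `^ (p / 2) <= 1.
Proof.
move=> p2; have pp : 0 < p - 1 by lra.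
have p0 : 0 < p by lra.
set rho := (p - 1) / p; have r0 : 0 < rho by rewrite divr_gt0.
have lE : lower_const p = Num.sqrt 2 / p * rho `^ ((p - 1) / 2).
  rewrite /lower_const ltNge p2 /=; have [pE|//] := eqVneq p 2.
  rewrite /rho pE (_ : (2 - 1) / 2 = 2^-1 :> R); last by field.
  rewrite powR12_sqrt ?invr_ge0 // sqrtrV //.
  by rewrite mulrAC divff ?mul1r // gt_eqF // sqrtr_gt0.
have l0 : 0 <= lower_const p by rewrite lE mulr_ge0 ?powR_ge0 // divr_ge0 ?sqrtr_ge0 // ltW.
rewrite -powR_half_sqr // -powRM ?sqr_ge0 //; last first.
  by rewrite !mulr_ge0 ?powR_ge0 // ltW.
rewrite (_ : _ * _ = 1) ?powR1 //.
rewrite lE exprMn expr_div_n sqr_sqrtr // -(powR_mulrn 2 (powR_ge0 _ _)) -powRrM.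
rewrite (_ : (p - 1) / 2 * 2%:R = p - 1); last by field.
rewrite (_ : p / (p - 1) = rho^-1); last by rewrite invf_div.
have rp := powR_gt0 p r0.
have rV : rho^-1 `^ p = (rho `^ p)^-1.
  by rewrite -powR_inv1 ?(ltW r0) // -powRrM mulN1r powRN.
have rB : rho `^ (p - 1) = rho `^ p / rho.
  by rewrite powRB ?powRr1 ?(ltW r0) // (gt_eqF r0) implybT.
rewrite rV rB /rho; field.
by rewrite !gt_eqF.
Qed.

(** Put [rho = (p - 1) / p] and [y = lower_const p / rho].  As [y <= 1 / 4]
    implies [y^p <= 1 / 4], it is enough to bound [y].  The tangent at 1 gives
    [rho^(p-1) <= 1 / p], hence [y <= sqrt (rho / 2) / p^2], and
    [8 (p - 1) <= p^5] concludes. *)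
Lemma lower_const_lt2 {R : realType} (p : R) : 1 < p < 2 ->
  lower_const p `^ p * (4 * (p / (p - 1)) `^ p) <= 1.
Proof.
move=> /andP[p1 p2]; rewrite /lower_const p2.
have p0 : 0 < p by lra.
have pp : 0 < p - 1 by lra.
set rho := (p - 1) / p; have r0 : 0 < rho by rewrite divr_gt0.
have s2 : 0 < Num.sqrt 2 :> R by rewrite sqrtr_gt0.
rewrite (_ : p / (p - 1) = rho^-1); last by rewrite invf_div.
have a0 : 0 <= (p * Num.sqrt 2)^-1 * rho `^ (p + 2^-1).
  by rewrite mulr_ge0 ?powR_ge0 // invr_ge0 mulr_ge0 // ltW.
rewrite mulrCA -powRM ?invr_ge0 ?(ltW r0) //.
set y := _ * rho^-1.
have y0 : 0 < y.
  by rewrite mulr_gt0 ?invr_gt0 // mulr_gt0 ?invr_gt0 ?powR_gt0 // mulr_gt0.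
suff y4 : y <= 1 / 4.
  have : y `^ p <= y by rewrite ge1r_powR ?(ltW p1) // y0 /=; lra.
  lra.
have yE : y = (p * Num.sqrt 2)^-1 * (rho `^ (p - 1) * Num.sqrt rho).
  rewrite /y -mulrA; congr (_ * _); rewrite -powR12_sqrt ?(ltW r0) //.
  rewrite -(powR_inv1 (ltW r0)) -!powRD ?(gt_eqF r0) ?implybT //.
  by congr powR; ring.
have ru : rho `^ (p - 1) <= p^-1.
  have := @powR_tangent_le R 1 rho (p - 1) ltr01 (ltW r0).
  rewrite !powR1 mulr1 => /(_ ltac:(lra)) /le_trans; apply.
  by rewrite (_ : 1 + _ = p^-1) // /rho; field; lra.
have : Num.sqrt rho * 4 <= p ^+ 2 * Num.sqrt 2.
  rewrite -ler_sqr ?nnegrE ?mulr_ge0 ?sqrtr_ge0 ?(ltW p0) //.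
  rewrite !exprMn !sqr_sqrtr ?(ltW r0) // /rho.
  rewrite (_ : (p - 1) / p * 4 ^+ 2 = 16 * (p - 1) / p); last by ring.
  rewrite ler_pdivrMr //.
  have p4 : (2 * p - 1) ^+ 2 <= (p ^+ 2) ^+ 2.
    by rewrite ler_sqr ?nnegrE ?sqr_ge0 //; [have := sqr_ge0 (p - 1); lra | lra].
  have p8 : 8 * (p - 1) <= (2 * p - 1) ^+ 2 * p.
    have := sqr_ge0 (16 * (p - 1) - 3).
    have : 0 <= (p - 1) * (p - 1) ^+ 2 by rewrite mulr_ge0 ?sqr_ge0 // ltW.
    lra.
  have := ler_wpM2r (ltW p0) p4; lra.
move=> sr.
rewrite yE mulrC ler_pdivrMr ?mulr_gt0 //.
apply: le_trans (_ : p^-1 * Num.sqrt rho <= _).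
  by rewrite ler_wpM2r ?sqrtr_ge0.
rewrite -(ler_pM2l p0) mulrA divff ?(gt_eqF p0) // mul1r.
lra.
Qed.

(** * Domination of the transforms *)

Lemma normr_mul_le_powR {R : realType} (a b D K1 K2 p : R) : 1 < p -> 0 <= D ->
  `|a| <= K1 * D `^ (p - 1) -> `|b| <= K2 * D -> `|a * b| <= K1 * K2 * D `^ p.
Proof.
move=> p1 D0 aD bD; rewrite normrM.
apply: le_trans (ler_pM (normr_ge0 a) (normr_ge0 b) aD bD) _.
by rewrite mulrACA powRB1K // (lt_trans ltr01).
Qed.

Lemma normr_linear_le {R : realType} (a b u v U V D : R) :
  `|u| <= U * D -> `|v| <= V * D -> `|a * u + b * v| <= (`|a| * U + `|b| * V) * D.
Proof.
move=> uU vV; apply: le_trans (ler_normD _ _) _.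
by rewrite !normrM mulrDl -!mulrA lerD // ler_wpM2l.
Qed.

Lemma powR_le_scale {R : realType} (a K D e : R) : 0 <= a -> 0 <= K -> 0 <= D -> 0 <= e ->
  a <= K * D -> a `^ e <= K `^ e * D `^ e.
Proof.
move=> a0 K0 D0 e0 aKD; rewrite -powRM //.
by rewrite ge0_ler_powR ?nnegrE // mulr_ge0.
Qed.

(** Every weight is dominated by the power [p - 1] of the function whose [p]-th
    power is on the right of the estimate where the weight is used. *)
Section integrand_bounds.
Context {R : realType} (p : R) (x : nat -> R) (k n : nat).
Hypotheses (p1 : 1 < p) (x0 : x 0%N = 0) (kn : (k <= n)%N).

Let p10 : 0 <= p - 1. Proof. by rewrite subr_ge0 ltW. Qed.

Lemma doob_integrand_le : `|max_abs x k `^ (p - 1) * Num.sg (x k)|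
  <= n%:R `^ (p - 1) * Num.sqrt (quad_var x n) `^ (p - 1).
Proof.
rewrite normrM normr_sg (ger0_norm (powR_ge0 _ _)).
apply: le_trans (_ : max_abs x k `^ (p - 1) <= _).
  by rewrite ler_piMr ?powR_ge0 // lern1 leq_b1.
by rewrite powR_le_scale ?max_abs_ge0 ?sqrtr_ge0 // max_abs_le_quad_var.
Qed.

Lemma normr_powRB1_le_quad_var :
  `|x k| `^ (p - 1) <= n%:R `^ (p - 1) * Num.sqrt (quad_var x n) `^ (p - 1).
Proof.
rewrite powR_le_scale ?sqrtr_ge0 //.
exact: le_trans (normr_le_max_abs x0 (leqnn k)) (max_abs_le_quad_var x x0 kn).
Qed.

Lemma dpow_le_quad_var : `|dpow p (x k)|
  <= p * n%:R `^ (p - 1) * Num.sqrt (quad_var x n) `^ (p - 1).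
Proof.
apply: le_trans (normr_dpow_le p (x k) p1) _; rewrite -mulrA ler_wpM2l //.
  by rewrite (le_trans ler01) // ltW.
exact: normr_powRB1_le_quad_var.
Qed.

Lemma dpow_le_max_abs : `|dpow p (x k)| <= p * max_abs x n `^ (p - 1).
Proof.
apply: le_trans (normr_dpow_le p (x k) p1) _; rewrite ler_wpM2l //.
  by rewrite (le_trans ler01) // ltW.
by rewrite ge0_ler_powR ?nnegrE ?max_abs_ge0 // normr_le_max_abs.
Qed.

Lemma square_integrand_le : p < 2 ->
  `|(x k ^+ 2 + quad_var x k) `^ (p / 2 - 1) * x k|
  <= n%:R `^ (p - 1) * Num.sqrt (quad_var x n) `^ (p - 1).
Proof.
move=> p2; apply: le_trans normr_powRB1_le_quad_var.
have [->|xn] := eqVneq (x k) 0; first by rewrite mulr0 normr0 powR_ge0.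
have a0 : 0 < `|x k| by rewrite normr_gt0.
have x2 : 0 < x k ^+ 2 by rewrite exprn_even_gt0.
rewrite normrM (ger0_norm (powR_ge0 _ _)).
have -> : `|x k| `^ (p - 1) = (x k ^+ 2) `^ (p / 2 - 1) * `|x k|.
  rewrite -[x k ^+ 2]ger0_norm ?sqr_ge0 // normrX.
  rewrite (_ : p / 2 - 1 = (p - 2) / 2); last by field.
  rewrite powR_half_sqr // -[X in _ * X]powRr1 // -powRD ?(gt_eqF a0) ?implybT //.
  by congr powR; ring.
rewrite ler_wpM2r //.
rewrite -[p / 2 - 1]opprB !powRN lef_pV2 ?posrE ?powR_gt0 ?ltr_wpDr ?quad_var_ge0 //.
have e0 : 0 <= 1 - p / 2 by lra.
rewrite (ge0_ler_powR e0) ?nnegrE ?addr_ge0 ?quad_var_ge0 ?(ltW x2) //.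
by rewrite lerDl quad_var_ge0.
Qed.

Lemma garsia_integrand_le : 2 < p ->
  `|quad_var x k `^ (p / 2 - 1) * x k|
  <= (4 * n%:R) `^ (p / 2 - 1) * max_abs x n `^ (p - 1).
Proof.
move=> p2; rewrite normrM (ger0_norm (powR_ge0 _ _)).
have m0 : 0 <= max_abs x n by exact: max_abs_ge0.
have -> : max_abs x n `^ (p - 1) = (max_abs x n ^+ 2) `^ (p / 2 - 1) * max_abs x n.
  rewrite (_ : p / 2 - 1 = (p - 2) / 2); last by field.
  rewrite powR_half_sqr // (_ : p - 2 = p - 1 - 1); last by ring.
  by rewrite powRB1K //; lra.
rewrite mulrA; apply: ler_pM; rewrite ?powR_ge0 //; last exact: normr_le_max_abs.
rewrite powR_le_scale ?quad_var_ge0 ?sqr_ge0 ?mulr_ge0 //; first by lra.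
exact: quad_var_le_max_abs.
Qed.

End integrand_bounds.

(** * Comparison of moments *)

Lemma square_functionE {T : Type} {R : realType} (X : nat -> T -> R) n w :
  square_function X n w = Num.sqrt (quad_var (X ^~ w) n).
Proof. by rewrite /square_function big_add1. Qed.

Section moments.
Context {d} {T : measurableType d} {R : realType} {P : probability T R}
  {F : nat -> set (set T)} {X : nat -> T -> R} (p : R) (n : nat).
Hypotheses (p1 : 1 < p) (fF : filtration F) (mX : martingale P F X)
  (X0 : forall w, X 0%N w = 0).

Let A w := max_abs (X ^~ w) n `^ p.
Let S w := Num.sqrt (quad_var (X ^~ w) n) `^ p.

Let mXT j : measurable_fun setT (X j) := martingale_measurable fF mX X0.

Let mA : measurable_fun setT A.
Proof. by apply/measurable_powR_comp/measurable_max_abs => j _. Qed.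

Let mS : measurable_fun setT S.
Proof.
apply/measurable_powR_comp/(measurableT_comp sqrtr_measurable).
by apply: measurable_quad_var => j _.
Qed.

Let A0 w : 0 <= A w. Proof. exact: powR_ge0. Qed.
Let S0 w : 0 <= S w. Proof. exact: powR_ge0. Qed.

Let adapted k : (1 <= k)%N -> forall j, (j <= k)%N ->
  measurable_fun setT (X j : g_sigma_algebraType (F k) -> R).
Proof.
move=> k1 [|j] jk; last exact: (martingale_adapted fF mX).
by rewrite (_ : X 0%N = cst 0); [exact: measurable_cst | exact/funext].
Qed.

Let mdpow c k : (1 <= k)%N -> measurable_wrt (F k) (fun w => c * dpow p (X k w)).
Proof.
move=> k1; apply: measurable_funM; first exact: measurable_cst.
by apply: (measurableT_comp (measurable_dpow p)); exact: adapted.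
Qed.

Let mdoob c k : (1 <= k)%N ->
  measurable_wrt (F k) (fun w => c * (max_abs (X ^~ w) k `^ (p - 1) * Num.sg (X k w))).
Proof.
move=> k1; apply: measurable_funM; first exact: measurable_cst.
apply: measurable_funM.
  by apply/measurable_powR_comp/measurable_max_abs; exact: adapted.
by apply: (measurableT_comp sgr_measurable); exact: adapted.
Qed.

Let increment_le_S k w : (k < n)%N ->
  `|X k.+1 w - X k w| <= 1 * Num.sqrt (quad_var (X ^~ w) n).
Proof. by rewrite mul1r; exact: normr_increment_le_sqrt_quad_var. Qed.

Let increment_le_A k w : (k < n)%N ->
  `|X k.+1 w - X k w| <= 2 * max_abs (X ^~ w) n.
Proof. exact: normr_increment_le_max_abs. Qed.

Lemma moment_upper : ('E_P[S] <= (upper_const p `^ p)%:E * 'E_P[A])%E.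
Proof.
have p0 : 0 < p := lt_trans ltr01 p1.
have [p2|p2] := leP p 2.
  have p12 : 1 < p <= 2 by rewrite p1.
  rewrite upper_const_le2 //; set c := 2 / (p * (p - 1)).
  have c0 : 0 < c by rewrite divr_gt0 // mulr_gt0 // subr_gt0.
  apply: (@transform_dominated _ _ _ _ _ _ n
    (fun k w => - (c `^ (p / 2) * (p / 2)) * dpow p (X k w)) _ _ _
    (`|- (c `^ (p / 2) * (p / 2))| * p * 2) fF mX) => //.
  - exact: powR_gt0.
  - by move=> w; rewrite X0 dpow0 mulr0.
  - exact: mdpow.
  - move=> k w kn; apply: normr_mul_le_powR => //; [exact: max_abs_ge0 | | exact: increment_le_A].
    rewrite normrM -mulrA ler_wpM2l //.
    by apply: (@dpow_le_max_abs _ _ (X ^~ w)) => //; exact: ltnW.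
  - by move=> w; exact: upper_path_le2.
rewrite upper_const_gt2 //; set c := - (2 * (p / 2) ^+ 2).
apply: (@transform_dominated _ _ _ _ _ _ n
  (fun k w => c * (quad_var (X ^~ w) k `^ (p / 2 - 1) * X k w)) _ _ _
  (`|c| * (4 * n%:R) `^ (p / 2 - 1) * 2) fF mX) => //.
- by rewrite powR_gt0 // mulr_gt0.
- by move=> w; rewrite X0 !mulr0.
- move=> k k1; apply: measurable_funM; first exact: measurable_cst.
  apply: measurable_funM; last exact: adapted.
  by apply/measurable_powR_comp/measurable_quad_var; exact: adapted.
- move=> k w kn; apply: normr_mul_le_powR => //; [exact: max_abs_ge0 | | exact: increment_le_A].
  rewrite normrM -mulrA ler_wpM2l //.
  by apply: (@garsia_integrand_le _ _ (X ^~ w)) => //; exact: ltnW.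
- by move=> w; exact: upper_path_gt2.
Qed.

Lemma moment_lower : ((lower_const p `^ p)%:E * 'E_P[A] <= 'E_P[S])%E.
Proof.
have p0 : 0 < p := lt_trans ltr01 p1.
have pp : 0 < p - 1 by rewrite subr_gt0.
have ES : (0 <= 'E_P[S])%E.
  by rewrite unlock; apply: integral_ge0 => w _; rewrite lee_fin.
have reduce B : lower_const p `^ p * B <= 1 -> ('E_P[A] <= B%:E * 'E_P[S])%E ->
    ((lower_const p `^ p)%:E * 'E_P[A] <= 'E_P[S])%E.
  move=> B1 AB; have l0 := powR_ge0 (lower_const p) p.
  apply: le_trans (_ : (lower_const p `^ p)%:E * (B%:E * 'E_P[S]) <= _)%E.
    by rewrite lee_wpmul2l // lee_fin.
  rewrite muleA -EFinM -[leRHS]mul1e lee_wpmul2r // lee_fin //.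
have [p2|p2] := leP 2 p.
  apply: (reduce _ (lower_const_ge2 p p2)).
  set a := p / 2 * (p / (p - 1)) `^ p; set b := - (p / 2 * (p * (p / (p - 1)))).
  apply: (@transform_dominated _ _ _ _ _ _ n
    (fun k w => a * dpow p (X k w)
       + b * (max_abs (X ^~ w) k `^ (p - 1) * Num.sg (X k w))) _ _ _
    ((`|a| * (p * n%:R `^ (p - 1)) + `|b| * n%:R `^ (p - 1)) * 1) fF mX) => //.
  - by rewrite powR_gt0 // mulr_gt0 ?powR_gt0 // divr_gt0 // mulr_gt0.
  - by move=> w; rewrite X0 dpow0 sgr0 !mulr0 addr0.
  - by move=> k k1; apply: measurable_funD; [exact: mdpow | exact: mdoob].
  - move=> k w kn; apply: normr_mul_le_powR => //; last exact: increment_le_S.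
    apply: normr_linear_le.
      by apply: (@dpow_le_quad_var _ _ (X ^~ w)) => //; exact: ltnW.
    by apply: (@doob_integrand_le _ _ (X ^~ w)) => //; exact: ltnW.
  - by move=> w; exact: lower_path_ge2.
have p12 : 1 < p < 2 by rewrite p1.
apply: (reduce _ (lower_const_lt2 p p12)).
set a := (p / (p - 1)) `^ p * p; set b := - (p * (p / (p - 1))).
apply: (@transform_dominated _ _ _ _ _ _ n
  (fun k w => a * ((X k w ^+ 2 + quad_var (X ^~ w) k) `^ (p / 2 - 1) * X k w)
     + b * (max_abs (X ^~ w) k `^ (p - 1) * Num.sg (X k w))) _ _ _
  ((`|a| * n%:R `^ (p - 1) + `|b| * n%:R `^ (p - 1)) * 1) fF mX) => //.
- by rewrite mulr_gt0 // powR_gt0 // divr_gt0.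
- by move=> w; rewrite X0 sgr0 !mulr0 addr0.
- move=> k k1; apply: measurable_funD; last exact: mdoob.
  apply: measurable_funM; first exact: measurable_cst.
  apply: measurable_funM; last exact: adapted.
  apply/measurable_powR_comp/measurable_funD.
    by apply: measurable_funX; exact: adapted.
  by apply: measurable_quad_var; exact: adapted.
- move=> k w kn; apply: normr_mul_le_powR => //; last exact: increment_le_S.
  apply: normr_linear_le.
    by apply: (@square_integrand_le _ _ (X ^~ w)) => //; exact: ltnW.
  by apply: (@doob_integrand_le _ _ (X ^~ w)) => //; exact: ltnW.
- by move=> w; exact: lower_path_lt2.
Qed.

End moments.

Theorem mainTheorem2 (R : realType) (d : measure_display)
    (T : measurableType d) (P : probability T R)
    (F : nat -> set (set T)) (X : nat -> T -> R) (p : R) (n : nat) :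
  1 < p ->
  filtration F -> martingale P F X -> (forall w : T, X 0%N w = 0) ->
  (1 <= n)%N ->
  ((lower_const p `^ p)%R%:E * 'E_P[(fun w => running_max X n w `^ p)%R]
     <= 'E_P[(fun w => square_function X n w `^ p)%R])%E /\
  ('E_P[(fun w => square_function X n w `^ p)%R]
     <= (upper_const p `^ p)%R%:E * 'E_P[(fun w => running_max X n w `^ p)%R])%E.
Proof.
move=> p1 fF mX X0 _.
have -> : (fun w => square_function X n w `^ p) =
    (fun w => Num.sqrt (quad_var (X ^~ w) n) `^ p).
  by apply/funext => w; rewrite square_functionE.
by split; [exact: (moment_lower p n p1 fF mX X0) | exact: (moment_upper p n p1 fF mX X0)].
Qed.
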